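(* Let $(\mathcal{A},\varphi)$ be a $C^*$-probability space such that $\varphi$ is a faithful, tracial state. Let $\mathbb{X},\mathbb{Y}\in\mathcal{A}$ be free, with $\mathbb{X}$ free Poisson distributed with parameters $(\lambda,\alpha)$ and $\mathbb{Y}$ free Poisson distributed with parameters $(\kappa,\alpha)$, where $\lambda+\kappa>1$. Then the random variables $$\mathbb{U}=(\mathbb{X}+\mathbb{Y})^{-1/2}\,\mathbb{X}\,(\mathbb{X}+\mathbb{Y})^{-1/2}\qquad\text{and}\qquad \mathbb{V}=\mathbb{X}+\mathbb{Y}$$ are free.
   Context: A $C^*$-probability space is a pair $(\mathcal{A},\varphi)$ with $\mathcal{A}$ a unital $C^*$-algebra with unit $\mathbb{I}$ and $\varphi:\mathcal{A}\to\mathbb{C}$ linear with $\varphi(\mathbb{I})=1$ and $\varphi(\mathbb{X}^*\mathbb{X})\ge 0$ for all $\mathbb{X}$. The distribution of a self-adjoint $\mathbb{X}\in\mathcal{A}$ is the probability measure $\mu$ on $\mathbb{R}$ with $\varphi(\mathbb{X}^r)=\int t^r\,\mu(dt)$ for all $r\ge 1$. Freeness: unital subalgebras $\mathcal{A}_1,\dots,\mathcal{A}_n$ of $\mathcal{A}$ are free if $\varphi(\mathbb{X}_1\cdots\mathbb{X}_k)=0$ whenever $\mathbb{X}_j\in\mathcal{A}_{i(j)}$, $\varphi(\mathbb{X}_j)=0$ for all $j$, and $i(1)\neq i(2)\neq\cdots\neq i(k)$. Random variables $\mathbb{X},\mathbb{Y}$ are free if the unital subalgebras generated by $(\mathbb{X},\mathbb{I})$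 and by $(\mathbb{Y},\mathbb{I})$ are free. Free Poisson distribution: for $\lambda\ge 0$, $\alpha>0$, a self-adjoint element is free Poisson distributed with parameters $(\lambda,\alpha)$ (rate $\lambda$, jump size $\alpha$) if its distribution is $$\nu(\lambda,\alpha)=\max\{0,1-\lambda\}\,\delta_0+\tilde\nu,$$ where $\tilde\nu$ is the measure supported on $(\alpha(1-\sqrt\lambda)^2,\alpha(1+\sqrt\lambda)^2)$ with density $\frac{1}{2\pi\alpha x}\sqrt{4\lambda\alpha^2-(x-\alpha(1+\lambda))^2}$ with respect to Lebesgue measure. ($\nu(0,\alpha)=\delta_0$.) Under the hypotheses, $\mathbb{X}+\mathbb{Y}$ is free Poisson distributed with parameters $(\lambda+\kappa,\alpha)$, and since $\lambda+\kappa>1$ it is positive and invertible, so that $(\mathbb{X}+\mathbb{Y})^{-1/2}$ is defined. *)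

(* Defs.v *)
From HB Require Import structures.
From mathcomp Require Import all_boot all_order all_algebra.
From mathcomp Require Import all_classical all_reals all_analysis.
From mathcomp Require Import measurable_realfun.
From mathcomp Require Import complex ring lra.

Set Implicit Arguments.
Unset Strict Implicit.
Unset Printing Implicit Defensive.

Import Order.TTheory GRing.Theory Num.Theory.
Import numFieldNormedType.Exports.

Local Open Scope classical_set_scope.
Local Open Scope ring_scope.

(* The norm is a field of this mixin, not inherited from
   [completeNormedModType], because the hierarchy has no structure joining
   (noncommutative) algebras and normed modules and does not allow adding one
   afterwards. *)
HB.mixin Record isCStarAlgebra (R : realType) A of GRing.Algebra R[i] A := {
  star : A -> A ;
  cnorm : A -> R ;
  starD : {morph star : x y / x + y} ;
  starZ : forall (a : R[i]) (x : A), star (a *: x) = a^* *: star x ;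
  starM : forall x y : A, star (x * y) = star y * star x ;
  starK : involutive star ;
  cnorm0_eq0 : forall x : A, cnorm x = 0 -> x = 0 ;
  cnormZ : forall (a : R[i]) (x : A), cnorm (a *: x) = Normc.normc a * cnorm x ;
  ler_cnormD : forall x y : A, cnorm (x + y) <= cnorm x + cnorm y ;
  ler_cnormM : forall x y : A, cnorm (x * y) <= cnorm x * cnorm y ;
  cnorm_starM : forall x : A, cnorm (star x * x) = cnorm x ^+ 2 ;
  cnorm_complete : forall u : nat -> A,
    (forall e : R, 0 < e ->
       exists N, forall m n, (N <= m)%N -> (N <= n)%N ->
         cnorm (u m - u n) < e) ->
    exists l : A, forall e : R, 0 < e ->
      exists N, forall n, (N <= n)%N -> cnorm (u n - l) < e
}.

#[short(type="cstarAlgType")]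
HB.structure Definition CStarAlgebra (R : realType) :=
  {A of GRing.Algebra R[i] A & isCStarAlgebra R A}.

Section cstar_algebra.
Context {R : realType} {A : cstarAlgType R}.
Implicit Types x w : A.

Definition selfadjoint x := star x = x.

Definition positive x := exists y : A, x = star y * y.

Definition is_inv_sqrt x w :=
  [/\ positive w, w * w * x = 1 & x * (w * w) = 1].

(* [x^(-1/2)] for positive invertible [x]; the value is [0] when there is no
   inverse square root. *)
Definition inv_sqrt x : A := xget 0 [set w | is_inv_sqrt x w].

Definition unital_subalgebra (B : set A) :=
  [/\ B 1, forall (a : R[i]) x y, B x -> B y -> B (a *: x + y)
    & forall x y, B x -> B y -> B (x * y)].

Definition subalgebra_gen x : set A := smallest unital_subalgebra [set x; 1].

End cstar_algebra.

Section states.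
Context {R : realType} {A : cstarAlgType R}.
Variable phi : {scalar A}.

(* [0 <= z] in [R[i]] means that [z] is real and nonnegative. *)
Definition state := phi 1 = 1 /\ forall x : A, 0 <= phi (star x * x).

Definition faithful := forall x : A, phi (star x * x) = 0 -> x = 0.

Definition tracial := forall x y : A, phi (x * y) = phi (y * x).

(* Words are the first [k] terms of sequences indexed by [nat]; [k > 0] since
   the empty product [1] is never centered. *)
Definition free_subalgebras (n : nat) (B : 'I_n -> set A) :=
  forall (k : nat) (i : nat -> 'I_n) (x : nat -> A), (0 < k)%N ->
    (forall j, (j < k)%N -> B (i j) (x j) /\ phi (x j) = 0) ->
    (forall j, (j.+1 < k)%N -> i j != i j.+1) ->
    phi (\prod_(j < k) x j) = 0.

Definition free_pair (x y : A) :=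
  free_subalgebras
    (fun b : 'I_2 => if b == ord0 then subalgebra_gen x else subalgebra_gen y).

Definition has_distribution (x : A) (mu : {measure set R -> \bar R}) :=
  [/\ selfadjoint x, mu [set: R] = 1%E &
      forall r : nat, (1 <= r)%N ->
        mu.-integrable [set: R] (fun t => (t ^+ r)%:E) /\
        phi (x ^+ r) = (\int[mu]_t (t ^+ r))%:C%C].

End states.

Section free_poisson.
Context {R : realType}.
Variables lambda alpha : R.
Local Notation lebesgue := (@lebesgue_measure R).

(* The interval is empty when [lambda < 0] or [alpha <= 0], so this is
   nonnegative for all values of the parameters. *)
Definition free_poisson_density (x : R) : R :=
  if (alpha * (1 - Num.sqrt lambda) ^+ 2 < x) &&
     (x < alpha * (1 + Num.sqrt lambda) ^+ 2)
  then (2 * pi * alpha * x)^-1 *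
       Num.sqrt (4 * lambda * alpha ^+ 2 - (x - alpha * (1 + lambda)) ^+ 2)
  else 0.

Lemma free_poisson_support_gt0 x :
  alpha * (1 - Num.sqrt lambda) ^+ 2 < x ->
  x < alpha * (1 + Num.sqrt lambda) ^+ 2 -> 0 < alpha /\ 0 < x.
Proof.
move=> ax xb; have s0 := sqrtr_ge0 lambda.
have sq : (1 - Num.sqrt lambda) ^+ 2 <= (1 + Num.sqrt lambda) ^+ 2.
  by rewrite -subr_ge0 subr_sqr; nra.
have a0 : 0 < alpha.
  rewrite ltNge; apply/negP => a0; have := lt_trans ax xb.
  by apply/negP; rewrite -leNgt ler_wnM2l.
by split=> //; apply: (le_lt_trans _ ax); rewrite mulr_ge0 ?sqr_ge0 ?(ltW a0).
Qed.

Lemma free_poisson_density_ge0 x : 0 <= free_poisson_density x.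
Proof.
rewrite /free_poisson_density; case: ifPn => // /andP[ax xb].
have [a0 x0] := free_poisson_support_gt0 ax xb.
by rewrite mulr_ge0 ?sqrtr_ge0// invr_ge0 !mulr_ge0 ?pi_ge0 ?ltW.
Qed.

Lemma measurable_free_poisson_density :
  measurable_fun [set: R] free_poisson_density.
Proof.
have m_id : measurable_fun [set: R] (fun x : R => x) by exact: measurable_id.
apply: measurable_fun_if => //=.
  by apply: measurable_and; apply: measurable_fun_ltr.
set lo := alpha * _; set hi := alpha * _.
have -> : [set: R] `&` (fun x => (lo < x) && (x < hi)) @^-1` [set true] =
          `]lo, hi[%classic.
  by rewrite setTI; apply/seteqP; split => x /=; rewrite in_itv.
apply: open_continuous_measurable_fun; first exact: interval_open.
move=> x; rewrite inE/= in_itv/= => /andP[ax xb].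
have [a0 x0] : 0 < alpha /\ 0 < x by exact: free_poisson_support_gt0 ax xb.
apply: cvgM.
  apply: continuousV; first by rewrite !mulf_neq0// ?gt_eqF ?pi_gt0.
  by apply: cvgM => //; exact: cvg_cst.
apply: continuous_comp; last exact: sqrt_continuous.
apply: cvgB; first exact: cvg_cst.
rewrite /continuous_at expr2; under eq_fun do rewrite expr2.
by apply: cvgM; apply: cvgB => //; exact: cvg_cst.
Qed.

Definition free_poisson_ac (U : set R) : \bar R :=
  (\int[lebesgue]_(x in U) (free_poisson_density x)%:E)%E.

Let free_poisson_ac0 : free_poisson_ac set0 = 0%E.
Proof. by rewrite /free_poisson_ac integral_set0. Qed.

Let free_poisson_ac_ge0 U : (0 <= free_poisson_ac U)%E.
Proof.
by apply: integral_ge0 => x _; rewrite lee_fin free_poisson_density_ge0.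
Qed.

Let free_poisson_ac_sigma_additive : semi_sigma_additive free_poisson_ac.
Proof.
move=> /= F mF tF mUF; rewrite /free_poisson_ac; apply: cvg_toP.
  apply: ereal_nondecreasing_is_cvgn => m n mn.
  apply: lee_sum_nneg_natr => // k _ _.
  by apply: integral_ge0 => /= x Fkx; rewrite lee_fin free_poisson_density_ge0.
rewrite ge0_integral_bigcup//=.
- apply: measurable_funTS; apply: measurableT_comp => //.
  exact: measurable_free_poisson_density.
- by move=> x _; rewrite lee_fin free_poisson_density_ge0.
Qed.

HB.instance Definition _ := isMeasure.Build _ _ _ free_poisson_ac
  free_poisson_ac0 free_poisson_ac_ge0 free_poisson_ac_sigma_additive.

Lemma free_poisson_atom_ge0 : 0 <= Num.max 0 (1 - lambda).
Proof. by rewrite le_max lexx. Qed.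

Definition free_poisson_measure : {measure set R -> \bar R} :=
  measure_add (mscale (NngNum free_poisson_atom_ge0) \d_(0 : R))
              free_poisson_ac.

End free_poisson.

Definition free_poisson (R : realType) (A : cstarAlgType R) (phi : {scalar A})
    (lambda alpha : R) (x : A) :=
  has_distribution phi x (free_poisson_measure lambda alpha).

(* Main.v *)
Require Import Defs.
From mathcomp Require Import all_boot all_order all_algebra.
From mathcomp Require Import all_classical all_reals all_analysis.
From mathcomp Require Import measurable_realfun.
From mathcomp Require Import complex ring lra.

(* Let V = X + Y and W = V^-1 X, and let D be the derivation of the polynomials
   in X and Y into A (x) A with D X = 1 (x) X and D Y = 1
     (x) Y. Freeness and the
   quadratic recurrence of the free Poisson moments yield the Schwinger-Dyson
   equation
     phi (V a) = alpha (lambda + kappa) phi a + alpha (phi (x) phi) (D a).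
   For powers of Z = 1 - V / c, with c = alpha (1 + lambda + kappa), it gives a
   Catalan-type recurrence, whence phi (Z^n) = O (q^n) with
   q = 2 sqrt (lambda + kappa) / (1 + lambda + kappa) < 1; as phi is faithful,
   the norm of Z is at most q, so V is invertible and V^-1 is a norm limit of
   polynomials in V. Therefore the equation extends to V^-1, with
   D V^-1 = - V^-1 (x) 1, and then D W = 0 while D V = 1 (x) V: restricted to
   the algebra generated by V and W, the equation forces V and W to be free.
   Finally, since phi is tracial, conjugation by V^(-1/2), which maps U to W and
   fixes V, preserves phi. *)

(** The tensor term comes from the convolution in the moment recurrence: D X^j is the sum of X^i (x)
    X^(j-i) over i < j. Its coefficient is the jump size; since X and Y share it, their two
    equations add up to one for V, in which only the rates are summed. D is not symmetric in its two
    legs. It kills V^-1 X, because - V^-1 (x) X cancels V^-1 (x) X, but it sends X V^-1 to 1 (x) X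
    V^-1 - X V^-1 (x) 1. Hence the choice of W, which also keeps the square root out of every
    differentiation. The law of V is never computed. One expects its support to be centred at c with
    half-width 2 alpha sqrt (lambda + kappa), so that q is the expected norm of Z, and lambda +
    kappa > 1 is what keeps 0 outside. D is neither a map on A, as the generators may satisfy
    relations, nor continuous for the norm. Each element therefore carries its derivative along, and
    limits are taken of both at once. *)

Set Implicit Arguments.
Unset Strict Implicit.
Unset Printing Implicit Defensive.

Import Order.TTheory GRing.Theory Num.Theory.
Import numFieldNormedType.Exports.

Local Open Scope classical_set_scope.
Local Open Scope ring_scope.

(* The [ring] tactic only handles commutative rings; [ncring] decides
   equalities of noncommutative polynomials with integer coefficients. *)
Inductive ncexpr :=
  | NCvar of nat | NC0 | NC1 | NCadd of ncexpr & ncexpr | NCopp of ncexpr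
  | NCmul of ncexpr & ncexpr | NCmuln of ncexpr & nat | NCexp of ncexpr & nat.

Section ncring.
Variable A : pzRingType.
Implicit Types (e : ncexpr) (env : seq A) (p q : seq (int * seq nat)).

Fixpoint nceval env e : A :=
  match e with
  | NCvar i => env`_i | NC0 => 0 | NC1 => 1
  | NCadd e1 e2 => nceval env e1 + nceval env e2
  | NCopp e1 => - nceval env e1
  | NCmul e1 e2 => nceval env e1 * nceval env e2
  | NCmuln e1 n => nceval env e1 *+ n
  | NCexp e1 n => nceval env e1 ^+ n
  end.

Definition ncmon env (m : seq nat) : A := \prod_(i <- m) env`_i.

Definition ncpoly env p : A := \sum_(cm <- p) ncmon env cm.2 *~ cm.1.

Fixpoint ncins (c : int) (m : seq nat) p :=
  if p is (c', m') :: q then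
    if m == m' then (if c + c' == 0 then q else (c + c', m) :: q)
    else (c', m') :: ncins c m q
  else [:: (c, m)].

Definition ncaddp p q := foldr (fun cm => ncins cm.1 cm.2) q p.

Definition ncmulp p q :=
  foldr (fun cm r => ncaddp [seq (cm.1 * dn.1, cm.2 ++ dn.2) | dn <- q] r)
    [::] p.

Definition ncscale (c : int) p := [seq (c * dn.1, dn.2) | dn <- p].

Fixpoint ncnorm e : seq (int * seq nat) :=
  match e with
  | NCvar i => [:: (1, [:: i])] | NC0 => [::] | NC1 => [:: (1, [::])]
  | NCadd e1 e2 => ncaddp (ncnorm e1) (ncnorm e2)
  | NCopp e1 => ncscale (- 1) (ncnorm e1)
  | NCmul e1 e2 => ncmulp (ncnorm e1) (ncnorm e2)
  | NCmuln e1 n => ncscale n%:Z (ncnorm e1)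
  | NCexp e1 n => iter n (ncmulp (ncnorm e1)) [:: (1, [::])]
  end.

Lemma ncpoly_ins env c m p :
  ncpoly env (ncins c m p) = ncmon env m *~ c + ncpoly env p.
Proof.
elim: p => [|[c' m'] q ih] /=; first by rewrite /ncpoly !big_cons.
case: eqP => [<-|_]; last by rewrite /ncpoly !big_cons -/(ncpoly _ _) ih addrCA.
rewrite {2}/ncpoly big_cons addrA -mulrzDr -/(ncpoly _ _) /=.
by case: eqP => [->|_]; rewrite ?mulr0z ?add0r// /ncpoly big_cons.
Qed.

Lemma ncpoly_add env p q : ncpoly env
  (ncaddp p q) = ncpoly env p + ncpoly env q.
Proof.
elim: p => [|[c m] p ih] /=; first by rewrite /ncpoly big_nil add0r.
by rewrite ncpoly_ins ih addrA /ncpoly big_cons.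
Qed.

Lemma ncpoly_scale env c p : ncpoly env (ncscale c p) = ncpoly env p *~ c.
Proof.
rewrite /ncpoly big_map mulrz_suml; apply: eq_bigr => i _ /=.
by rewrite mulrC mulrzA.
Qed.

Lemma ncpoly_mul env p q : ncpoly env
  (ncmulp p q) = ncpoly env p * ncpoly env q.
Proof.
elim: p => [|[c m] p ih] /=; first by rewrite /ncpoly big_nil mul0r.
rewrite ncpoly_add ih [ncpoly _ (_ :: _)]/ncpoly big_cons mulrDl;
  congr (_ + _) => //=.
rewrite /ncpoly big_map mulr_sumr; apply: eq_bigr => i _ /=.
by rewrite /ncmon big_cat/= mulrzAl mulrzAr -mulrzA mulrC.
Qed.

Lemma ncpolyE env e : ncpoly env (ncnorm e) = nceval env e.
Proof.
elim: e => [i|||e1 ih1 e2 ih2|e1 ih1|e1 ih1 e2 ih2|e1 ih1 n|e1 ih1 n] /=.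
- by rewrite /ncpoly /ncmon !big_seq1.
- by rewrite /ncpoly big_nil.
- by rewrite /ncpoly /ncmon big_seq1 big_nil.
- by rewrite ncpoly_add ih1 ih2.
- by rewrite ncpoly_scale ih1 mulrNz.
- by rewrite ncpoly_mul ih1 ih2.
- by rewrite ncpoly_scale ih1.
- elim: n => [|n ih] /=; first by rewrite /ncpoly /ncmon big_seq1 big_nil.
  by rewrite ncpoly_mul ih1 ih exprS.
Qed.

(** Monomials are kept in no particular order, so equal polynomials may have permuted lists;
    normalizing the difference and testing it for emptiness avoids sorting. *)
Lemma ncring_correct env e1 e2 :
  ncnorm (NCadd e1 (NCopp e2)) == [::] -> nceval env e1 = nceval env e2.
Proof.
move=> /eqP h; apply/eqP; rewrite -subr_eq0; apply/eqP.
by rewrite -[LHS](ncpolyE env (NCadd e1 (NCopp e2))) h /ncpoly big_nil.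
Qed.

End ncring.

Ltac nc_index x env :=
  lazymatch env with
  | x :: _ => constr:(0%N)
  | _ :: ?env' => let n := nc_index x env' in constr:(n.+1)
  end.

Ltac nc_mem x env :=
  lazymatch env with
  | [::] => constr:(false)
  | x :: _ => constr:(true)
  | _ :: ?env' => nc_mem x env'
  end.

Ltac nc_env env t :=
  lazymatch t with
  | 0 => env
  | 1 => env
  | ?a + ?b => let env' := nc_env env a in nc_env env' b
  | - ?a => nc_env env a
  | ?a * ?b => let env' := nc_env env a in nc_env env' b
  | ?a *+ _ => nc_env env a
  | ?a ^+ ?n =>
    lazymatch isnatconst n with true => nc_env env a | _ => nc_atom env t end
  | _ => nc_atom env t
  end
with nc_atom env t :=
  lazymatch nc_mem t env with true => env | false => constr:(t :: env) end
with isnatconst n :=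
  lazymatch n with O => constr:(true) | S ?m => isnatconst m | _ =>
    constr:(false) end.

Ltac nc_quote env t :=
  lazymatch t with
  | 0 => constr:(NC0)
  | 1 => constr:(NC1)
  | ?a + ?b => let u := nc_quote env a in let v := nc_quote env b in
               constr:(NCadd u v)
  | - ?a => let u := nc_quote env a in constr:(NCopp u)
  | ?a * ?b => let u := nc_quote env a in let v := nc_quote env b in
               constr:(NCmul u v)
  | ?a *+ ?n => let u := nc_quote env a in constr:(NCmuln u n)
  | ?a ^+ ?n =>
    lazymatch isnatconst n with
    | true => let u := nc_quote env a in constr:(NCexp u n)
    | _ => let i := nc_index t env in constr:(NCvar i)
    end
  | _ => let i := nc_index t env in constr:(NCvar i)
  end.

Ltac ncring :=
  lazymatch goal with
  | |- @eq ?A ?a ?b =>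
    let env0 := nc_env (@nil A) a in
    let env := nc_env env0 b in
    let u := nc_quote env a in
    let v := nc_quote env b in
    apply: (@ncring_correct _ env u v); vm_compute; reflexivity
  end.

(** * Square roots, inverses and norms in C*-algebras *)

Section cnorm_theory.
Context {R : realType} {A : cstarAlgType R}.
Implicit Types (x y z t : A) (a b : R) (k : R[i]).

Lemma normc_real a : Normc.normc a%:C%C = `|a|.
Proof. by rewrite /Normc.normc /= expr0n /= addr0 sqrtr_sqr. Qed.

Lemma normcE k : (Normc.normc k)%:C%C = `|k|.
Proof. by []. Qed.

Lemma normc_ge0 k : 0 <= Normc.normc k.
Proof. by rewrite -ler0c normcE normr_ge0. Qed.

Lemma cnorm0 : cnorm (0 : A) = 0.
Proof. by rewrite -(scale0r 0) cnormZ Normc.normc0 mul0r. Qed.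

Lemma cnormN x : cnorm (- x) = cnorm x.
Proof. by rewrite -scaleN1r cnormZ normcN Normc.normc1 mul1r. Qed.

Lemma cnorm_ge0 x : 0 <= cnorm x.
Proof.
have := ler_cnormD x (- x); rewrite subrr cnorm0 cnormN.
by rewrite -mulr2n pmulrn_lge0.
Qed.

Lemma cnormB x y : cnorm (x - y) = cnorm (y - x).
Proof. by rewrite -cnormN opprB. Qed.

Lemma ler_cnormB x y : cnorm (x - y) <= cnorm x + cnorm y.
Proof. by rewrite -(cnormN y) ler_cnormD. Qed.

Lemma cnormZr a x : cnorm (a%:C%C *: x) = `|a| * cnorm x.
Proof. by rewrite cnormZ normc_real. Qed.

Lemma cnorm_eq_small x : (forall e, 0 < e -> cnorm x < e) -> x = 0.
Proof.
move=> h; apply: cnorm0_eq0; apply/eqP; rewrite eq_le cnorm_ge0 andbT.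
by apply/ler_addgt0Pl => e /h /ltW; rewrite addr0.
Qed.

Lemma star0 : star (0 : A) = 0.
Proof. by rewrite -(scale0r (0 : A)) starZ rmorph0 !scale0r. Qed.

Lemma starN x : star (- x) = - star x.
Proof. by apply/eqP; rewrite eq_sym -subr_eq0 -opprD oppr_eq0 -starD subrr
  star0. Qed.

Lemma starB x y : star (x - y) = star x - star y.
Proof. by rewrite starD starN. Qed.

Lemma star1 : star (1 : A) = 1.
Proof. by rewrite -[LHS]mul1r -[X in X * _](starK 1) -starM mul1r starK. Qed.

Lemma starZr a x : star (a%:C%C *: x) = a%:C%C *: star x.
Proof. by rewrite starZ; congr (_ *: _); exact: conjc_real. Qed.

Lemma starX x n : star (x ^+ n) = star x ^+ n.
Proof. by elim: n => [|n ih];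
  rewrite ?expr0 ?star1// exprS starM ih exprSr. Qed.

Lemma cnorm1 : cnorm (1 : A) = 1.
Proof.
have := cnorm_starM (1 : A); rewrite star1 mulr1 => /eqP.
rewrite -subr_eq0 expr2 -[X in X - _]mulr1 -mulrBr mulf_eq0 =>
  /orP[/eqP/cnorm0_eq0/eqP|].
  by rewrite oner_eq0.
by rewrite subr_eq0 => /eqP.
Qed.

Lemma cnormX_le x n : cnorm (x ^+ n) <= cnorm x ^+ n.
Proof.
elim: n => [|n ih]; first by rewrite !expr0 cnorm1.
by rewrite !exprS (le_trans (ler_cnormM _ _))// ler_wpM2l ?cnorm_ge0.
Qed.

Lemma cnorm_star x : cnorm (star x) = cnorm x.
Proof.
have h y : cnorm y <= cnorm (star y).
  have [->|y0] := eqVneq (cnorm y) 0; first exact: cnorm_ge0.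
  have y1 : 0 < cnorm y by rewrite lt_neqAle eq_sym y0 cnorm_ge0.
  by rewrite -(ler_pM2r y1) -expr2 -cnorm_starM ler_cnormM.
by apply/eqP; rewrite eq_le h -{2}(starK x) h.
Qed.

End cnorm_theory.


Section sqrt_and_inverse.
Context {R : realType} {A : cstarAlgType R}.
Implicit Types (x y z t b : A) (a e K : R) (k : R[i]) (u : nat -> A).

Definition cconv u (l : A) := forall e, 0 < e ->
  exists N, forall n, (N <= n)%N -> cnorm (u n - l) < e.

(** Identities pass to limits through this lemma. Two consecutive terms occur in the bound because
    the limits below come from recurrences linking [u n] and [u n.+1]. *)
Lemma cconv_eq0 u l x K : cconv u l ->
  (forall n, cnorm x <= K * (cnorm (u n - l) + cnorm (u n.+1 - l))) -> x = 0.
Proof.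
move=> ul xK; apply: cnorm_eq_small => e e0.
have K0 : 0 < 2 * (`|K| + 1) by rewrite mulr_gt0// ltr_pwDr.
have [N hN] := ul _ (divr_gt0 e0 K0).
apply: (le_lt_trans (xK N)).
have h1 := hN N (leqnn N); have h2 := hN N.+1 (leqnSn N).
apply: (@le_lt_trans _ _ ((`|K| + 1) * (cnorm (u N - l) + cnorm (u N.+1 - l)))).
  by rewrite ler_wpM2r ?addr_ge0 ?cnorm_ge0// (le_trans (ler_norm K))// lerDl.
rewrite -ltr_pdivlMl ?ltr_pwDr//.
rewrite (_ : _ * e = e / (2 * (`|K| + 1)) + e / (2 * (`|K| + 1))) ?ltrD//.
by field; rewrite gt_eqF// ltr_pwDr.
Qed.

Lemma cconv_comm u l b : cconv u l -> (forall n, b * u n = u n * b) ->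
  b * l = l * b.
Proof.
move=> ul bu; apply/eqP; rewrite -subr_eq0; apply/eqP.
apply: (cconv_eq0 (K := 2 * cnorm b) ul) => n.
have -> : b * l - l * b = (u n - l) * b - b * (u n - l).
  rewrite mulrBr mulrBl bu; ncring.
rewrite (le_trans (ler_cnormB _ _))// [X in _ <= X]mulrDr -[X in X <= _]addr0
  lerD//.
  rewrite -mulrA mulr_natl mulr2n lerD// (le_trans (ler_cnormM _ _))//.
  by rewrite mulrC.
by rewrite mulr_ge0 ?cnorm_ge0// mulr_ge0 ?cnorm_ge0.
Qed.

Lemma cconv_star u l : cconv u l -> (forall n, star (u n) = u n) -> star l = l.
Proof.
move=> ul su; apply/eqP; rewrite -subr_eq0; apply/eqP.
apply: (cconv_eq0 (K := 2) ul) => n.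
have -> : star l - l = (u n - l) - star (u n - l) by rewrite starB su; ncring.
rewrite (le_trans (ler_cnormB _ _))// cnorm_star mulrDr mulr_natl mulr2n.
by rewrite lerDl mulr_ge0 ?cnorm_ge0.
Qed.

(** Neumann series. The last clause at [b = t] turns the left inverse into a two-sided one. *)
Lemma exists_inv1B t : cnorm t < 1 -> exists y, [/\ y * (1 - t) = 1,
  star t = t -> star y = y & forall b, b * t = t * b -> b * y = y * b].
Proof.
move=> t1; pose q := cnorm t; pose u n := \sum_(i < n) t ^+ i.
have q0 : 0 <= q := cnorm_ge0 t.
have uS n : u n.+1 = u n + t ^+ n by rewrite /u big_ord_recr.
have q1 : 0 < 1 - q by rewrite subr_gt0.
have uB d n : cnorm (u (d + n)%N - u n) <= q ^+ n / (1 - q) * (1 - q ^+ d).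
  elim: d => [|d ih]; first by rewrite add0n subrr cnorm0 expr0 subrr mulr0.
  rewrite addSn uS addrAC (le_trans (ler_cnormD _ _))//.
  rewrite (le_trans (lerD ih (cnormX_le _ _)))// -/q exprD exprS.
  by rewrite le_eqVlt; apply/orP; left; apply/eqP; field; rewrite gt_eqF.
have [l ul] : exists l, cconv u l.
  apply: cnorm_complete => e e0.
  have [N hN] : exists N, q ^+ N / (1 - q) < e / 2.
    have : (fun n => q ^+ n) @ \oo --> (0 : R) by apply: cvg_expr;
      rewrite ger0_norm.
    have e2 : 0 < e / 2 * (1 - q) by rewrite mulr_gt0 ?divr_gt0.
    move/cvgr_lt => /(_ _ e2)[N _ hN]; exists N; rewrite ltr_pdivrMr//.
    exact: (hN N (leqnn N)).
  have h n : (N <= n)%N -> cnorm (u n - u N) < e / 2.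
    move=> Nn; rewrite -(subnK Nn); apply: le_lt_trans (uB _ _) _.
    by rewrite (le_lt_trans _ hN)// ler_piMr ?divr_ge0 ?exprn_ge0 ?(ltW q1)//
      gerBl exprn_ge0.
  exists N => m n Nm Nn; rewrite (_ : u m - u n = (u m - u N) - (u n - u N));
    last by ncring.
  by rewrite (le_lt_trans (ler_cnormB _ _))// (splitr e) ltrD// h.
exists l; split.
- apply/eqP; rewrite -subr_eq0; apply/eqP; apply: (cconv_eq0 (K := 3) ul) => n.
  have un : u n * (1 - t) = 1 - t ^+ n.
    elim: n => [|n ih]; first by rewrite /u big_ord0 mul0r expr0 subrr.
    by rewrite uS mulrDl ih exprSr mulrBr mulr1; ncring.
  (* The defect [u n * (1 - t) - 1 = - t ^+ n] is also [u n - u n.+1], so it is controlled by the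
     distances to [l]. *)
  have -> : l * (1 - t) - 1 = (u n - l) * t - (u n - l) + ((u n - l) -
    (u n.+1 - l)).
    rewrite uS (_ : u n - l - _ = - t ^+ n); last by ncring.
    have -> : t ^+ n = 1 - u n * (1 - t) by rewrite un; ncring.
    ncring.
  rewrite (le_trans (ler_cnormD _ _))//.
  have := ler_cnormB (u n - l) (u n.+1 - l).
  have := ler_cnormB ((u n - l) * t) (u n - l).
  have := le_trans (ler_cnormM (u n - l) t) (ler_piMr (cnorm_ge0 _) (ltW t1)).
  have := cnorm_ge0 (u n.+1 - l); lra.
- move=> tt; apply: cconv_star ul _ => n; elim: n => [|n ih].
    by rewrite /u big_ord0 star0.
  by rewrite uS starD starX tt ih.
- move=> b bt; apply: cconv_comm ul _ => n.
  rewrite /u mulr_sumr mulr_suml; apply: eq_bigr => i _.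
  by rewrite commrX.
Qed.

Fixpoint sqrt_maj n : R := if n is m.+1 then 2^-1 *
  (1 + sqrt_maj m ^+ 2) else 0.

Lemma sqrt_maj_itv n : 0 <= sqrt_maj n <= 1.
Proof.
elim: n => [|n /andP[h0 h1]] /=; first by rewrite lexx ler01.
have : sqrt_maj n ^+ 2 <= 1 by rewrite expr_le1.
have := sqr_ge0 (sqrt_maj n); lra.
Qed.

Lemma sqrt_maj_cauchy e : 0 < e -> exists N, forall n, (N <= n)%N ->
  sqrt_maj n - sqrt_maj N < e.
Proof.
move=> e0; have hs : has_sup (range sqrt_maj).
  split; first by exists (sqrt_maj 0), 0%N.
  by exists 1 => _ [n _ <-]; case/andP: (sqrt_maj_itv n).
have [_ [N _ <-] hN] := sup_adherent e0 hs.
exists N => n _; rewrite ltrBlDr -ltrBlDl (le_lt_trans _ hN)// lerD2r.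
by apply: ub_le_sup; [case: hs|exists n].
Qed.

Lemma half_scaler2 x : ((2^-1 : R)%:C%C *: x) *+ 2 = x.
Proof.
rewrite -scaler_nat scalerA -(rmorph_nat (real_complex R)) -rmorphM/= mulfV//.
exact: scale1r.
Qed.

Fixpoint sqrt_iter t n : A :=
  if n is m.+1 then (2^-1 : R)%:C%C *: (t + sqrt_iter t m ^+ 2) else 0.

Lemma sqrt_iter_comm t b n : b * t = t * b ->
  b * sqrt_iter t n = sqrt_iter t n * b.
Proof.
move=> bt; elim: n => [|n ih] /=; first by rewrite mulr0 mul0r.
by rewrite -scalerAr -scalerAl mulrDr mulrDl bt expr2 mulrA ih -mulrA ih mulrA.
Qed.

Lemma star_sqrt_iter t n : star t = t -> star (sqrt_iter t n) = sqrt_iter t n.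
Proof.
by move=> tt; elim: n => [|n ih] /=; rewrite ?star0// starZr starD starX ih tt.
Qed.

Lemma cnorm_sqrt_iter t n : cnorm t <= 1 -> cnorm (sqrt_iter t n) <= sqrt_maj n.
Proof.
move=> t1; elim: n => [|n ih] /=; first by rewrite cnorm0.
rewrite cnormZr ger0_norm ?invr_ge0// ler_wpM2l ?invr_ge0//.
rewrite (le_trans (ler_cnormD _ _))// lerD// (le_trans (cnormX_le _ _))//.
by rewrite lerXn2r// ?nnegrE ?cnorm_ge0 ?(le_trans (cnorm_ge0 _) ih).
Qed.

(** The iterates commute, so an increment is half the product of the previous increment and a sum of
    two iterates; the scalar iteration factors in the same way, and domination passes from one
    increment to the next. *)
Lemma sqrt_iterB t n : cnorm t <= 1 ->
  cnorm (sqrt_iter t n.+1 - sqrt_iter t n) <= sqrt_maj n.+1 - sqrt_maj n.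
Proof.
move=> t1; elim: n => [|n ih].
  rewrite /= !subr0 expr0n/= !addr0 expr0n /= addr0 cnormZr.
  by rewrite ger0_norm ?invr_ge0// ler_wpM2l ?invr_ge0.
set v := sqrt_iter t in ih *; set s := sqrt_maj in ih *.
have -> : v n.+2 - v n.+1 =
    (2^-1 : R)%:C%C *: ((v n.+1 - v n) * (v n.+1 + v n)).
  rewrite [v n.+2]/= [v n.+1 in X in _ - X = _]/= -/v -scalerBr; congr (_ *: _).
  rewrite opprD addrACA subrr add0r mulrDr !mulrBl -!expr2.
  have -> : v n * v n.+1 = v n.+1 * v n.
    by apply: sqrt_iter_comm; rewrite sqrt_iter_comm.
  by rewrite addrA subrK.
have -> : s n.+2 - s n.+1 = 2^-1 * ((s n.+1 - s n) * (s n.+1 + s n)).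
  by rewrite /s /=; field.
rewrite cnormZr ger0_norm ?invr_ge0// ler_wpM2l ?invr_ge0//.
rewrite (le_trans (ler_cnormM _ _))// ler_pM ?cnorm_ge0//.
by rewrite (le_trans (ler_cnormD _ _))// lerD// cnorm_sqrt_iter.
Qed.

Lemma sqrt_iter_maj t m n : cnorm t <= 1 -> (n <= m)%N ->
  cnorm (sqrt_iter t m - sqrt_iter t n) <= sqrt_maj m - sqrt_maj n.
Proof.
move=> t1 nm; rewrite -(subnK nm); elim: (m - n)%N => [|d ih].
  by rewrite add0n !subrr cnorm0.
rewrite addSn -[sqrt_iter t (d + n).+1](subrK (sqrt_iter t (d + n))) -addrA.
rewrite (le_trans (ler_cnormD _ _))//.
rewrite -[sqrt_maj (d + n).+1](subrK (sqrt_maj (d + n))) -addrA lerD//.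
exact: sqrt_iterB.
Qed.

(* [1 - y] is the limit of the iteration [z |-> (t + z ^+ 2) / 2] from [0], which
   is dominated by the same scalar iteration at [t = 1]. *)
Lemma exists_sqrt1B t : cnorm t <= 1 -> exists y,
  [/\ y * y = 1 - t, star t = t -> star y = y,
      forall b, b * t = t * b -> b * y = y * b & cnorm (1 - y) <= 1].
Proof.
move=> t1.
have [l hl] : exists l, cconv (sqrt_iter t) l.
  apply: cnorm_complete => e e0.
  have e2 : 0 < e / 2 by rewrite divr_gt0.
  have [N hN] := sqrt_maj_cauchy e2; exists N => m n Nm Nn.
  rewrite -(subrK (sqrt_iter t N) (sqrt_iter t m)) -addrA.
  rewrite (le_lt_trans (ler_cnormD _ _))// (splitr e) ltrD//.
    by rewrite (le_lt_trans (sqrt_iter_maj _ _))// hN.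
  by rewrite cnormB (le_lt_trans (sqrt_iter_maj _ _))// hN.
have l1 : cnorm l <= 1.
  apply/ler_addgt0Pl => e /hl[N /(_ N (leqnn N)) /ltW hN].
  rewrite -(subrK (sqrt_iter t N) l) (le_trans (ler_cnormD _ _))// lerD//.
    by rewrite cnormB.
  by rewrite (le_trans (cnorm_sqrt_iter _ _))//; case/andP: (sqrt_maj_itv N).
have eql : l *+ 2 - (t + l ^+ 2) = 0.
  apply: (cconv_eq0 (K := 2) hl) => n.
  have -> : l *+ 2 - (t + l ^+ 2) = (l - sqrt_iter t n.+1) *+ 2 +
      (sqrt_iter t n * (sqrt_iter t n - l) + (sqrt_iter t n - l) * l).
    have -> : (l - sqrt_iter t n.+1) *+ 2 = l *+ 2 - (t + sqrt_iter t n ^+ 2).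
      by rewrite mulrnBl /= half_scaler2.
    ncring.
  rewrite (le_trans (ler_cnormD _ _))// [X in _ <= X]mulrDr addrC lerD//.
    rewrite (le_trans (ler_cnormD _ _))// mulr_natl mulr2n lerD//;
    rewrite (le_trans (ler_cnormM _ _))//.
      rewrite ler_piMl ?cnorm_ge0// (le_trans (cnorm_sqrt_iter _ _))//.
      by case/andP: (sqrt_maj_itv n).
    by rewrite ler_piMr ?cnorm_ge0.
  by rewrite mulr_natl !mulr2n (le_trans (ler_cnormD _ _))// cnormB.
exists (1 - l); split.
- by rewrite -[LHS]addr0 -eql; ncring.
- move=> tt; rewrite starB star1; congr (_ - _).
  by apply: cconv_star hl _ => n; exact: star_sqrt_iter.
- move=> b bt; rewrite mulrBr mulrBl mulr1 mul1r; congr (_ - _).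
  by apply: cconv_comm hl _ => n; exact: sqrt_iter_comm.
(* This bound stands in for positivity of the root: it allows the lemma to be applied to [1 - y],
   which gives a square root of [y]. *)
- by rewrite (_ : 1 - (1 - l) = l)//; ncring.
Qed.

End sqrt_and_inverse.

Lemma geometric_le0 (R : realType) (q s K a : R) : 0 <= q -> q < s ->
  (forall n, s ^+ n * a <= K * q ^+ n) -> a <= 0.
Proof.
move=> q0 qs h; have s0 : 0 < s by exact: le_lt_trans qs.
have : (fun n => K * (q / s) ^+ n) @ \oo --> K * 0.
  apply: cvgM; first exact: cvg_cst.
  by apply: cvg_expr; rewrite ger0_norm ?divr_ge0 ?(ltW s0)// ltr_pdivrMr//
    mul1r.
rewrite mulr0 => kq; apply: (cvgr_to_ge kq); apply: nearW => n.
by rewrite expr_div_n mulrA ler_pdivlMr ?exprn_gt0// mulrC.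
Qed.

(** * Absolute values and inverse square roots of self-adjoint elements *)

Section selfadjoint.
Context {R : realType} {A : cstarAlgType R}.
Implicit Types (x y z h g : A) (a s : R).

Lemma selfadjoint_mul x y : selfadjoint x -> selfadjoint y -> x * y = y * x ->
  selfadjoint (x * y).
Proof. by rewrite /selfadjoint starM => -> ->. Qed.

Lemma selfadjointB x y : selfadjoint x -> selfadjoint y -> selfadjoint (x - y).
Proof. by rewrite /selfadjoint starB => -> ->. Qed.

Lemma selfadjointD x y : selfadjoint x -> selfadjoint y -> selfadjoint (x + y).
Proof. by rewrite /selfadjoint starD => -> ->. Qed.

Lemma selfadjointZ a x : selfadjoint x -> selfadjoint (a%:C%C *: x).
Proof. by rewrite /selfadjoint starZr => ->. Qed.

Lemma selfadjointX x n : selfadjoint x -> selfadjoint (x ^+ n).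
Proof. by rewrite /selfadjoint starX => ->. Qed.

Lemma cnorm_sqr x : selfadjoint x -> cnorm (x * x) = cnorm x ^+ 2.
Proof. by move=> xx; rewrite -{1}xx cnorm_starM. Qed.

Lemma star_i x : star ('i%C *: x) = - ('i%C *: star x).
Proof. by rewrite starZ complexiE conjCi scaleNr. Qed.

Lemma cnorm_scaleV_le1 a x : 0 < a -> cnorm x <= a ->
  cnorm (a^-1%:C%C *: x) <= 1.
Proof.
move=> a0 xa; rewrite cnormZr ger0_norm; last by rewrite invr_ge0 ltW.
by rewrite ler_pdivrMl// mulr1.
Qed.

Lemma scaleri (a b : R) x : a%:C%C *: (b%:C%C *: x) = (a * b)%:C%C *: x.
Proof. by rewrite scalerA -rmorphM. Qed.

Lemma scaler_sqr a x : (a%:C%C *: x) * (a%:C%C *: x) = (a * a)%:C%C *: (x * x).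
Proof. by rewrite -scalerAl -scalerAr scaleri. Qed.

(* [x + iy] has square modulus [s], and [2x] is the sum of it and its adjoint. *)
Lemma cnorm_le_sumsq x y s : 0 <= s -> selfadjoint x -> selfadjoint y ->
  x * y = y * x -> x * x + y * y = s%:C%C *: 1 -> cnorm x ^+ 2 <= s.
Proof.
move=> s0 xx yy xy xys.
pose u := x + 'i%C *: y; pose v := x - 'i%C *: y.
have uv : star u = v by rewrite /u starD star_i xx yy.
have i2 z : 'i%C *: ('i%C *: z) = - z by rewrite scalerA -expr2 sqr_i scaleN1r.
have vu : v * u = s%:C%C *: 1.
  rewrite -xys /v /u mulrDr !mulrBl -!scalerAl -!scalerAr i2 xy.
  by rewrite opprK addrA subrK.
have nu : cnorm u ^+ 2 = s.
  by rewrite -cnorm_starM uv vu cnormZr cnorm1 mulr1 ger0_norm.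
have : cnorm (x *+ 2) <= cnorm u *+ 2.
  rewrite (_ : x *+ 2 = u + v); last by rewrite /u /v; ncring.
  by rewrite mulr2n (le_trans (ler_cnormD _ _))// -uv cnorm_star.
rewrite -scaler_nat -(rmorph_nat (real_complex R)) cnormZr ger0_norm ?ler0n//.
rewrite -[X in _ <= X]mulr_natl ler_pM2l ?ltr0n// => xu.
by rewrite -nu lerXn2r ?nnegrE ?cnorm_ge0.
Qed.

(** [h * h] is the absolute value of [x], and its root [h] witnesses positivity. For [t = x / s] of
    norm at most 1, take [y = sqrt (1 - t^2)], then [z = sqrt (1 - y^2) = |t|], then a root of [z];
    the relation [y^2 + t^2 = 1] bounds [y] as the second root requires. *)
Lemma exists_abs x : selfadjoint x -> exists h, [/\ selfadjoint h,
  h * h * (h * h) = x * x & forall b, b * x = x * b -> b * h = h * b].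
Proof.
move=> xx; pose s := cnorm x + 1.
have s0 : 0 < s by rewrite ltr_pwDr ?cnorm_ge0.
pose t := s^-1%:C%C *: x.
have st : selfadjoint t by exact: selfadjointZ.
have t1 : cnorm t <= 1.
  by rewrite cnorm_scaleV_le1// lerDl.
have bt b : b * x = x * b -> b * t = t * b.
  by move=> bx; rewrite -scalerAl -scalerAr bx.
have [|y [yy sy cy _]] := @exists_sqrt1B R A (t * t).
  by rewrite cnorm_sqr// expr_le1// cnorm_ge0.
have {}sy : star y = y by apply: sy; exact: selfadjoint_mul.
have ty : t * y = y * t by apply: cy; rewrite mulrA.
have yb b : b * x = x * b -> b * y = y * b.
  by move=> /bt ub; apply: cy; rewrite mulrA ub -mulrA ub mulrA.
have [|z [zz sz cz z1]] := @exists_sqrt1B R A (y * y).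
  rewrite cnorm_sqr//; apply: (@cnorm_le_sumsq y t) => //.
  by rewrite yy subrK scale1r.
have {}sz : star z = z by apply: sz; exact: selfadjoint_mul.
have zb b : b * x = x * b -> b * z = z * b.
  by move=> /yb ub; apply: cz; rewrite mulrA ub -mulrA ub mulrA.
have [h [hh sh ch _]] := exists_sqrt1B z1.
have {}hh : h * h = z by rewrite hh; ncring.
have {}sh : star h = h by apply: sh; rewrite starB star1 sz.
exists ((Num.sqrt s)%:C%C *: h); split.
- exact: selfadjointZ.
- have -> : ((Num.sqrt s)%:C%C *: h) * ((Num.sqrt s)%:C%C *: h) = s%:C%C *: z.
    by rewrite scaler_sqr hh -[Num.sqrt s * _]expr2 sqr_sqrtr// ltW.
  rewrite scaler_sqr zz yy.
  rewrite (_ : 1 - (1 - t * t) = t * t); last by ncring.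
  rewrite /t scaler_sqr scaleri (_ : s * s * (s^-1 * s^-1) = 1) ?scale1r//.
  by field; rewrite gt_eqF.
- move=> b bx; rewrite -scalerAl -scalerAr ch//.
  by rewrite mulrBr mulrBl zb// mulr1 mul1r.
Qed.

(** With [t = x / s], [T] the inverse of [1 - t] and [y] its square root, [T * y] squares to [T]. It
    is positive because it is itself the square of [T * y * k], where [k * k = y]. *)
Lemma exists_inv_sqrt x s : 0 < s -> selfadjoint x -> cnorm x < s ->
  exists w, is_inv_sqrt (s%:C%C *: 1 - x) w.
Proof.
move=> s0 sx xs; pose t := s^-1%:C%C *: x.
have st : star t = t by exact: selfadjointZ.
have t1 : cnorm t < 1.
  by rewrite cnormZr ger0_norm ?invr_ge0 ?(ltW s0)// ltr_pdivrMl// mulr1.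
have [y [yy sy cy y1]] := exists_sqrt1B (ltW t1).
have {}sy := sy st.
have [k [kk sk ck _]] := exists_sqrt1B y1.
have {}sk : star k = k by apply: sk; rewrite starB star1 sy.
have {}kk : k * k = y by rewrite kk; ncring.
have [T [Tt sT cT]] := exists_inv1B t1.
have {}sT := sT st.
have ty : t * y = y * t by apply: cy.
have Ty : T * y = y * T by apply/esym; exact: cT.
have tk : t * k = k * t by apply: ck; rewrite mulrBr mulrBl ty mulr1 mul1r.
have Tk : T * k = k * T by apply/esym; exact: cT.
have yk : y * k = k * y by rewrite -kk mulrA.
have Tt' : (1 - t) * T = 1.
  by move: Tt; rewrite mulrBr mulrBl mulr1 mul1r cT.
have sE : s%:C%C *: 1 - x = s%:C%C *: (1 - t).
  by rewrite scalerBr scaleri mulfV ?gt_eqF// scale1r.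
have ww : (Num.sqrt s)^-1%:C%C *: (T * y) * ((Num.sqrt s)^-1%:C%C *: (T * y)) =
    s^-1%:C%C *: T.
  rewrite scaler_sqr -expr2 exprVn sqr_sqrtr ?(ltW s0)//; congr (_ *: _).
  by rewrite {2}Ty -mulrA (mulrA y) yy Tt' mulr1.
exists ((Num.sqrt s)^-1%:C%C *: (T * y)); split.
- exists ((Num.sqrt (Num.sqrt s)^-1)%:C%C *: (T * y * k)).
  have -> : star ((Num.sqrt (Num.sqrt s)^-1)%:C%C *: (T * y * k)) =
      (Num.sqrt (Num.sqrt s)^-1)%:C%C *: (T * y * k).
    apply: selfadjointZ; apply: selfadjoint_mul => //.
      exact: selfadjoint_mul.
    by rewrite mulrA -Tk -!mulrA yk.
  rewrite scaler_sqr -expr2 sqr_sqrtr ?invr_ge0 ?sqrtr_ge0//; congr (_ *: _).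
  have -> : T * y * k * (T * y * k) = T * (y * y * T) * (k * k).
    have kq : k * (T * y) = T * y * k by rewrite mulrA -Tk -!mulrA yk.
    by rewrite -(mulrA (T * y) k) (mulrA k) kq {2}Ty -!mulrA.
  by rewrite yy Tt' kk mulr1.
- rewrite ww sE -scalerAl -scalerAr Tt scaleri mulVf ?gt_eqF//.
  exact: scale1r.
- rewrite ww sE -scalerAl -scalerAr Tt' scaleri mulfV ?gt_eqF//.
  exact: scale1r.
Qed.

End selfadjoint.

(** * Bounds on states, and norms from moments *)

Section state_theory.
Context {R : realType} {A : cstarAlgType R}.
Variable phi : {scalar A}.
Hypothesis sphi : state phi.
Implicit Types (x y z h g : A) (a s : R).

Lemma stateD x y : phi (x + y) = phi x + phi y. Proof. exact: raddfD. Qed.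
Lemma stateB x y : phi (x - y) = phi x - phi y. Proof. exact: raddfB. Qed.
Lemma stateZ k x : phi (k *: x) = k * phi x. Proof. exact: linearZ. Qed.

Lemma state_sqr_ge0 x : selfadjoint x -> 0 <= phi (x * x).
Proof. by move=> xx; rewrite -{1}xx; case: sphi. Qed.

(** For [e > 0], the element [cnorm y + e - y] is a positive multiple of the square of a
    self-adjoint one, so that [phi y <= cnorm y + e]. Being comparable with a real number makes
    [phi x] real, and the bound is applied to [x] and [- x]. *)
Lemma state_selfadjoint_norm_le x : selfadjoint x ->
  exists2 r, phi x = r%:C%C & `|r| <= cnorm x.
Proof.
have h e y : 0 < e -> selfadjoint y -> phi y <= (cnorm y + e)%:C%C.
  move=> e0 yy; have s0 : 0 < cnorm y + e by rewrite ltr_wpDl ?cnorm_ge0.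
  have [|z [zz sz _ _]] := @exists_sqrt1B R A ((cnorm y + e)^-1%:C%C *: y).
    by rewrite cnorm_scaleV_le1// lerDl ltW.
  have {}sz : selfadjoint z by apply: sz; exact: selfadjointZ.
  have := state_sqr_ge0 sz; rewrite zz stateB stateZ (proj1 sphi).
  have s0' : 0 < (cnorm y + e)%:C%C by rewrite ltcR.
  rewrite -(pmulr_rge0 _ s0') mulrBr mulr1 mulrA.
  by rewrite -rmorphM mulfV ?gt_eqF// mul1r subr_ge0.
move=> xx; have xN : selfadjoint (- x) by rewrite /selfadjoint starN xx.
have /complex_realP[r xr] : phi x \is Num.real.
  by rewrite (ler_real (h 1 x ltr01 xx)); apply/complex_realP; eexists.
exists r => //; rewrite ler_norml lerNl.
apply/andP; split; apply/ler_addgt0Pr => e e0; rewrite -lecR.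
  by rewrite rmorphN /= -xr -(cnormN x) -raddfN h.
by rewrite -xr h.
Qed.

(** The factor 2 comes from splitting [x] into real and imaginary parts; it is not sharp, but only
    the continuity of [phi] matters here. *)
Lemma state_bounded x : Normc.normc (phi x) <= 2 * cnorm x.
Proof.
pose u := 2^-1%:C%C *: (x + star x);
  pose v := (2^-1)%:C%C *: ('i%C *: (star x - x)).
have su : selfadjoint u.
  by apply: selfadjointZ; rewrite /selfadjoint starD starK addrC.
have sv : selfadjoint v.
  apply: selfadjointZ; rewrite /selfadjoint star_i starB starK.
  by rewrite -scalerN opprB.
have hx : x = u + 'i%C *: v.
  rewrite /v scalerA mulrC -scalerA [X in _ + _ *: X]scalerA -expr2 sqr_i.
  rewrite /u -scalerDr scaleN1r opprB.
  rewrite (_ : x + star x + (x - star x) = x *+ 2); last by ncring.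
  by rewrite -scalerMnr half_scaler2.
have nu : cnorm u <= cnorm x.
  rewrite cnormZr ger0_norm ?invr_ge0// ler_pdivrMl// mulr_natl mulr2n.
  by rewrite (le_trans (ler_cnormD _ _))// cnorm_star.
have nv : cnorm v <= cnorm x.
  rewrite cnormZr ger0_norm ?invr_ge0// ler_pdivrMl// mulr_natl mulr2n.
  rewrite cnormZ /Normc.normc/= expr0n add0r expr1n sqrtr1 mul1r.
  by rewrite (le_trans (ler_cnormB _ _))// cnorm_star.
have [a ua an] := state_selfadjoint_norm_le su.
have [b vb bn] := state_selfadjoint_norm_le sv.
have -> : phi x = a%:C%C + 'i%C * b%:C%C by rewrite -ua -vb -stateZ -stateD -hx.
rewrite (le_trans (le_normcD _ _))// Normc.normcM !normc_real.
rewrite /Normc.normc/= expr0n add0r expr1n sqrtr1 mul1r mulr_natl mulr2n.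
by rewrite lerD// ?(le_trans an)// (le_trans bn).
Qed.

Hypothesis fphi : faithful phi.

(* For [s > r^2], [g] is twice the positive part of [z^2 - s]: then
   [phi (z^(2n) g^2)] grows at least like [s^n], so that [g = 0]. *)
Lemma cnorm_le_of_moments z (C r s : R) : selfadjoint z -> 0 <= r ->
  r ^+ 2 < s ->
  (forall n, Normc.normc (phi (z ^+ (2 * n))) <= C * r ^+ (2 * n)) ->
  cnorm z ^+ 2 <= s.
Proof.
move=> zz r0 rs zC.
have s0 : 0 < s by rewrite (le_lt_trans (sqr_ge0 r)).
have [x xE] : exists x, x = z * z - s%:C%C *: 1 by eexists.
have s1 : selfadjoint (s%:C%C *: (1 : A)) by apply: selfadjointZ; exact: star1.
have sx : selfadjoint x by rewrite xE; apply: selfadjointB => //;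
  exact: selfadjoint_mul.
have [h [sh hx ch]] := exists_abs sx.
have [y yE] : exists y, y = h * h by eexists.
have zx : z * x = x * z.
  by rewrite xE mulrBr mulrBl mulrA -scalerAl -scalerAr mulr1 mul1r.
have zh : z * h = h * z by exact: ch.
have xh : x * h = h * x by exact: ch.
have sy : selfadjoint y by rewrite yE; exact: selfadjoint_mul.
have [g gE] : exists g, g = y + x by eexists.
have sg : selfadjoint g by rewrite gE; exact: selfadjointD.
have zg : z * g = g * z.
  by rewrite gE mulrDr mulrDl zx yE mulrA zh -mulrA zh mulrA.
have xy : x * y = y * x by rewrite yE mulrA xh -mulrA xh mulrA.
have gx : x * g = y * g.
  by rewrite gE !mulrDr -hx -yE xy addrC.
have hg : h * g = g * h.
  by rewrite gE mulrDr mulrDl xh yE mulrA.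
have zng n : z ^+ n * g = g * z ^+ n.
  by apply/esym; rewrite commrX.
have znh n : z ^+ n * h = h * z ^+ n.
  by apply/esym; rewrite commrX.
(* Since [x * g = |x| * g], the product [x * g * g] is the square of [h * g]; replacing one [z * z]
   by [s + x] therefore extracts a factor [s] and adds a square. *)
have low n : (s ^+ n)%:C%C * phi (g * g) <= phi (z ^+ (2 * n) * (g * g)).
  elim: n => [|n ih]; first by rewrite muln0 !expr0 mul1r mul1r.
  have -> : z ^+ (2 * n.+1) * (g * g) =
     s%:C%C *: (z ^+ (2 * n) * (g * g)) + (z ^+ n * h * g) * (z ^+ n * h * g).
    rewrite mulnS addnC exprD expr2 -mulrA [z * z * _]mulrA.
    have -> : z * z = s%:C%C *: 1 + x by rewrite xE addrC subrK.
    rewrite !mulrDl mulrDr -!scalerAl mul1r -scalerAr; congr (_ + _).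
    rewrite -(mulrA x).
    have -> : x * (g * g) = (h * g) * (h * g).
      by rewrite mulrA gx yE -!mulrA (mulrA g h) -hg -mulrA.
    rewrite mulnC exprM expr2 -(mulrA _ h g).
    have zq : z ^+ n * (h * g) = (h * g) * z ^+ n.
      by rewrite mulrA znh -mulrA zng mulrA.
    move: (h * g) zq => q zq.
    by rewrite -[RHS]mulrA [q * (_ * _)]mulrA -zq !mulrA.
  have -> : (s ^+ n.+1)%:C%C * phi (g * g) = s%:C%C * ((s ^+ n)%:C%C * phi
    (g * g)).
    by rewrite exprS rmorphM mulrA.
  rewrite stateD stateZ -[X in X <= _]addr0 lerD//.
    by rewrite ler_wpM2l// ler0c ltW.
  apply: state_sqr_ge0; apply: selfadjoint_mul => //.
  - by apply: selfadjoint_mul => //; exact: selfadjointX.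
  - by rewrite -mulrA hg mulrA zng -mulrA.
have [a ga an] := state_selfadjoint_norm_le (selfadjoint_mul sg sg erefl).
have K0 : 0 < cnorm (g * g) + 1 by rewrite ltr_pwDr ?cnorm_ge0.
(* [k] is a root of [1 - g * g / (cnorm (g * g) + 1)]; positivity of [phi] on the square of
   [z ^+ n * k] bounds the moments weighted by [g * g] by the plain ones. *)
have [|k [kk sk ck _]] := @exists_sqrt1B R A ((cnorm (g * g) + 1)^-1%:C%C *:
  (g * g)).
  by rewrite cnorm_scaleV_le1// lerDl.
have {}sk : selfadjoint k.
  by apply: sk; apply: selfadjointZ; apply: selfadjoint_mul.
have up n : phi (z ^+ (2 * n) * (g * g)) <=
    (cnorm (g * g) + 1)%:C%C * phi (z ^+ (2 * n)).
  have zk : z ^+ n * k = k * z ^+ n.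
    by apply: ck; rewrite -scalerAl -scalerAr mulrA zng -mulrA zng mulrA.
  have := state_sqr_ge0 (selfadjoint_mul (selfadjointX n zz) sk zk).
  rewrite mulrA -(mulrA _ k) -zk mulrA -mulrA kk mulrBr mulr1 -scalerAr.
  rewrite stateB stateZ subr_ge0 -exprD addnn -mul2n => up.
  rewrite -(ler_pM2l (x := (cnorm (g * g) + 1)^-1%:C%C)) ?ltcR ?invr_gt0//.
  by rewrite [X in _ <= X]mulrA -rmorphM mulVf ?gt_eqF// mul1r.
have a0 : a = 0.
  apply/eqP; rewrite eq_le -ler0c -ga state_sqr_ge0// andbT.
  apply: (@geometric_le0 _ (r ^+ 2) s ((cnorm (g * g) + 1) * C)) => //.
    exact: sqr_ge0.
  move=> n; have [b bE _] := state_selfadjoint_norm_le (selfadjointX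
    (2 * n) zz).
  have := le_trans (low n) (up n); rewrite ga bE -!rmorphM /= lecR => h1.
  rewrite (le_trans h1)// -mulrA ler_pM2l// -exprM.
  by have := zC n; rewrite bE normc_real; apply: le_trans; exact: ler_norm.
have /fphi g0 : phi (star g * g) = 0 by rewrite sg ga a0.
(* [g = 0] says that [h * h = s - z * z], so the squares of [z] and [h] add up to [s]. *)
apply: (@cnorm_le_sumsq _ _ z h) => //; first exact: ltW.
move/eqP: g0; rewrite gE addr_eq0 => /eqP y0.
by rewrite -yE y0 xE opprB addrC subrK.
Qed.

End state_theory.

(** * Formal derivatives and freeness *)

Section extension.
Context {R : realType} {A : cstarAlgType R}.
Local Notation C := R[i].

(* A pair [(a, d)] stands for an element [a] together with a formal derivative
   [D a] in [A (x) A], of which only the bilinear form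
   [d u v = (phi (x) phi) ((u (x) 1) * D a * (1 (x) v))] is remembered. *)
Definition dpair : Type := A * (A -> A -> C).
Implicit Types (x y z : dpair) (k : C) (a b u v : A).

Definition dpair1 : dpair := (1, fun _ _ => 0).
(** The second component is the Leibniz rule D (a b) = D a (1 (x) b) + (a (x) 1) D b, read on
    bilinear forms. *)
Definition dmul x y : dpair :=
  (x.1 * y.1, fun u v => x.2 u (y.1 * v) + y.2 (u * x.1) v).
Definition dlin k x y : dpair :=
  (k *: x.1 + y.1, fun u v => k * x.2 u v + y.2 u v).

Definition dbilin x :=
  (forall k u u' v, x.2 (k *: u + u') v = k * x.2 u v + x.2 u' v) /\
  (forall k u v v', x.2 u (k *: v + v') = k * x.2 u v + x.2 u v').

(** An algebra of pairs rather than a map: one element may carry several derivatives when the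
    generators satisfy relations, and the equations are proved for all of them, so that
    well-definedness of D is never at stake. *)
Inductive dalg (G : dpair -> Prop) : dpair -> Prop :=
| dalg_gen x : G x -> dalg G x
| dalg1 : dalg G dpair1
| dalg_lin k x y : dalg G x -> dalg G y -> dalg G (dlin k x y)
| dalg_mul x y : dalg G x -> dalg G y -> dalg G (dmul x y).

Lemma dalg_sub (G G' : dpair -> Prop) : (forall x, G x -> dalg G' x) ->
  forall x, dalg G x -> dalg G' x.
Proof.
move=> GG' x; elim=> {x} [x /GG' //||k x y _ ? _ ?|x y _ ? _ ?].
- exact: dalg1.
- exact: dalg_lin.
- exact: dalg_mul.
Qed.

Lemma dpair_eq x y : x.1 = y.1 -> (forall u v, x.2 u v = y.2 u v) -> x = y.
Proof.
case: x y => [a f] [b g] /= -> fg; congr (_, _).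
by apply/funext => u; apply/funext => v.
Qed.

Lemma dmulA x y z : dmul (dmul x y) z = dmul x (dmul y z).
Proof. by apply: dpair_eq => [|u v] /=; rewrite !mulrA// addrA. Qed.

Lemma dmul1 x : dmul x dpair1 = x.
Proof. by apply: dpair_eq => [|u v] /=; rewrite ?mul1r ?mulr1 ?addr0. Qed.

Lemma d1mul x : dmul dpair1 x = x.
Proof. by apply: dpair_eq => [|u v] /=; rewrite ?mul1r ?mulr1 ?add0r. Qed.

Lemma dlinl k x y z : dbilin z ->
  dmul (dlin k x y) z = dlin k (dmul x z) (dmul y z).
Proof.
move=> [zl _]; apply: dpair_eq => [|u v] /=.
  by rewrite mulrDl scalerAl.
rewrite mulrDr -scalerAr zl; ring.
Qed.

Lemma dlinr k x y z : dbilin x ->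
  dmul x (dlin k y z) = dlin k (dmul x y) (dmul x z).
Proof.
move=> [_ xl]; apply: dpair_eq => [|u v] /=.
  by rewrite mulrDr scalerAr.
rewrite mulrDl -scalerAl xl; ring.
Qed.

Lemma dbilin1 : dbilin dpair1.
Proof. by split=> *; rewrite /= mulr0 addr0. Qed.

Lemma dbilin_lin k x y : dbilin x -> dbilin y -> dbilin (dlin k x y).
Proof. by move=> [xl xr] [yl yr]; split=> * /=; rewrite ?(xl, yl, xr, yr);
  ring. Qed.

Lemma dbilin_mul x y : dbilin x -> dbilin y -> dbilin (dmul x y).
Proof.
move=> [xl xr] [yl yr]; split=> * /=;
  by rewrite ?(mulrDl, mulrDr) -?(scalerAl, scalerAr) ?(xl, yl, xr, yr); ring.
Qed.

Lemma dbilin_dalg G : (forall x, G x -> dbilin x) -> forall x,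
  dalg G x -> dbilin x.
Proof.
move=> Gb x; elim=> {x} [x /Gb //||k x y _ xb _ yb|x y _ xb _ yb].
- exact: dbilin1.
- exact: dbilin_lin.
- exact: dbilin_mul.
Qed.

Lemma dalg_subalgebra_gen a d x : dalg (eq^~ (a, d)) x -> subalgebra_gen a x.1.
Proof.
move=> xG B [[B1 Bl Bm] aB]; elim: xG => {x} [x ->|||] //=.
- by apply: aB; left.
- by move=> k x y _ xB _ yB; exact: Bl.
- by move=> x y _ xB _ yB; exact: Bm.
Qed.

Lemma subalgebra_gen_dalg a d b : subalgebra_gen a b ->
  exists2 x, dalg (eq^~ (a, d)) x & x.1 = b.
Proof.
move/(_ (fun b => exists2 x, dalg (eq^~ (a, d)) x & x.1 = b)); apply; split;
  last first.
  move=> _ [->|->]; first by exists (a, d) => //; exact: dalg_gen.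
  by exists dpair1 => //; exact: dalg1.
split; first by exists dpair1 => //; exact: dalg1.
- by move=> k _ _ [x xG <-] [y yG <-]; exists (dlin k x y) => //;
  exact: dalg_lin.
- by move=> _ _ [x xG <-] [y yG <-]; exists (dmul x y) => //; exact: dalg_mul.
Qed.

Lemma subalgebra_gen1 a : subalgebra_gen a 1.
Proof. by move=> F [[]]. Qed.

Lemma subalgebra_gen_id a : subalgebra_gen a a.
Proof. by move=> F [_]; apply; left. Qed.

Lemma subalgebra_gen_lin a k u v : subalgebra_gen a u -> subalgebra_gen a v ->
  subalgebra_gen a (k *: u + v).
Proof. by move=> h h' F FB; case: (FB) => -[_ Fl _] _; apply: Fl;
  [exact: h|exact: h']. Qed.

Lemma subalgebra_genM a u v : subalgebra_gen a u -> subalgebra_gen a v ->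
  subalgebra_gen a (u * v).
Proof. by move=> h h' F FB; case: (FB) => -[_ _ Fm] _; apply: Fm;
  [exact: h|exact: h']. Qed.

End extension.

Section free_derivation.
Context {R : realType} {A : cstarAlgType R} (phi : {scalar A}).
Local Notation C := R[i].
Implicit Types (x y z : dpair (A := A)) (k : C) (a b u v : A).

Definition dgen a : dpair (A := A) := (a, fun u v => phi u * phi (a * v)).

Lemma dbilin_dgen a : dbilin (dgen a).
Proof.
split=> * /=; first by rewrite stateD stateZ; ring.
by rewrite mulrDr -scalerAr stateD stateZ; ring.
Qed.

(* [n] multiplies [(phi (x) phi) (D x)]. *)
Definition schwinger_dyson a (m n : C) x :=
  phi (a * x.1) = m * phi x.1 + n * x.2 1 1.

Lemma schwinger_dyson_lin a m n k x y : schwinger_dyson a m n x ->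
  schwinger_dyson a m n y -> schwinger_dyson a m n (dlin k x y).
Proof.
rewrite /schwinger_dyson /= mulrDr -scalerAr !stateD !stateZ => -> ->; ring.
Qed.

Lemma schwinger_dyson_single a m n :
  (forall j, phi (a ^+ j.+1) = m * phi (a ^+ j) +
     n * \sum_(i < j) phi (a ^+ i) * phi (a ^+ (j - i))) ->
  forall x, dalg (eq^~ (dgen a)) x -> schwinger_dyson a m n x.
Proof.
move=> aE x xG.
(* [M y] is the equation for all [a ^+ j * y], with the derivative expanded; in this form it is
   stable under left multiplication by [a], hence by every polynomial in [a]. *)
pose M y := dbilin y /\ forall j,
  phi (a ^+ j.+1 * y.1) = m * phi (a ^+ j * y.1) +
     n * (\sum_(i < j) phi (a ^+ i) * phi (a ^+ (j - i) * y.1) + y.2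
       (a ^+ j) 1).
have M1 : M dpair1.
  split=> [|j]; first exact: dbilin1.
  by rewrite /= !mulr1 addr0 aE; congr (_ + _ * _); apply: eq_bigr => i _;
    rewrite mulr1.
have Ml k y z : M y -> M z -> M (dlin k y z).
  move=> [yb yM] [zb zM]; split=> [|j]; first exact: dbilin_lin.
  rewrite /= !mulrDr -!scalerAr !stateD !stateZ yM zM.
  under [in RHS]eq_bigr do rewrite mulrDr -scalerAr stateD stateZ mulrDr mulrCA.
  by rewrite big_split/= -mulr_sumr; ring.
have xb : dbilin x by apply: dbilin_dalg xG => _ ->; exact: dbilin_dgen.
have : forall y, M y -> M (dmul x y).
  elim: xG => {x xb} [x ->||k x y xG xM yG yM|x y xG xM yG yM] z Mz.
  - case: Mz => zb zM; split=> [|j].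
      by apply: dbilin_mul => //; exact: dbilin_dgen.
    rewrite /= mulrA -exprSr zM big_ord_recr/= mulrA -exprSr; congr (_ + _ * _).
    rewrite subSnn expr1 mulr1 -addrA; congr (_ + _).
    by apply: eq_bigr => i _; rewrite mulrA -exprSr -subSn// ltnW.
  - by rewrite d1mul.
  - by rewrite dlinl; [apply: Ml; [exact: xM|exact: yM]|case: Mz].
  - by rewrite dmulA; apply: xM; exact: yM.
move=> /(_ _ M1); rewrite dmul1 => -[_ /(_ 0%N)].
by rewrite /schwinger_dyson expr1 expr0 mul1r big_ord0 add0r.
Qed.

(** The left legs of the derivative lie in the algebra generated by [a], and the form applies [phi]
    to [u] times each of them. The next lemma is the mirror image for right legs. *)
Lemma dalg_vanish_l a u x : dalg (eq^~ (dgen a)) x ->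
  (forall b, subalgebra_gen a b -> phi (u * b) = 0) -> forall v, x.2 u v = 0.
Proof.
move=> xD; elim: xD u => {x} [x ->||k x y _ xh _ yh|x y xD xh _ yh] u uB v //=.
- have := uB 1 (@subalgebra_gen1 _ _ a).
  by rewrite mulr1 => ->; rewrite mul0r.
- by rewrite xh// yh// mulr0 addr0.
- rewrite xh// yh ?addr0// => b bB; rewrite -mulrA uB//.
  by apply: subalgebra_genM bB; exact: dalg_subalgebra_gen xD.
Qed.

Lemma dalg_vanish_r a v x : dalg (eq^~ (dgen a)) x ->
  (forall b, subalgebra_gen a b -> phi (b * v) = 0) -> forall u, x.2 u v = 0.
Proof.
move=> xD; elim: xD v => {x} [x ->||k x y _ xh _ yh|x y _ xh yD yh] v vB u //=.
- by rewrite (vB a) ?mulr0//; exact: subalgebra_gen_id.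
- by rewrite xh// yh// mulr0 addr0.
- rewrite yh// xh ?addr0// => b bB; rewrite mulrA vB//.
  by apply: subalgebra_genM bB _; exact: dalg_subalgebra_gen yD.
Qed.

Lemma subalgebra_gen_center a b : subalgebra_gen a b ->
  subalgebra_gen a (b - phi b *: 1).
Proof.
move=> ab; rewrite addrC -scaleNr; apply: subalgebra_gen_lin => //.
exact: subalgebra_gen1.
Qed.

Lemma phi_center a : phi 1 = 1 -> phi (a - phi a *: 1) = 0.
Proof. by move=> phi1; rewrite stateB stateZ phi1 mulr1 subrr. Qed.

End free_derivation.

(** * Freeness in terms of alternating words *)

Section alternating.
Context {R : realType} {A : cstarAlgType R} (phi : {scalar A}).
Implicit Types (a x y : A) (b e : bool).

(* [alternating B b e a]: [a] is an alternating product of centered elements of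
   [B true] and [B false], the first one in [B b] and the last one in [B e]. *)
Inductive alternating (B : bool -> set A) : bool -> bool -> A -> Prop :=
| alternating1 b a : B b a -> phi a = 0 -> alternating B b b a
| alternatingS b e a x : B b a -> phi a = 0 -> alternating B (~~ b) e x ->
    alternating B b e (a * x).

Definition gen_subalgebra x y b : set A := subalgebra_gen (if b then x else y).

Lemma alternating_rcons B b e a x : alternating B b e x -> B (~~ e) a ->
  phi a = 0 -> alternating B b (~~ e) (x * a).
Proof.
move=> xB Ba a0; elim: xB Ba => {b e x} [b x Bx x0 Ba|b e c x Bc c0 _ ih Ba].
  by apply: alternatingS => //; exact: alternating1.
by rewrite -mulrA; apply: alternatingS => //; exact: ih.
Qed.

Lemma free_pair_alternating x y : free_pair phi x y ->
  forall b e a, alternating (gen_subalgebra x y) b e a -> phi a = 0.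
Proof.
move=> xyF b e a aB.
suff [k [i [u [uB ui i0 <-]]]] : exists k (i : nat -> 'I_2) u,
    [/\ forall j, (j < k.+1)%N ->
        gen_subalgebra x y (i j == ord0) (u j) /\ phi (u j) = 0,
      forall j, (j.+1 < k.+1)%N -> i j != i j.+1, (i 0%N == ord0) = b
      & \prod_(j < k.+1) u j = a].
  apply: xyF ui => // j jk; have [+ ?] := uB _ jk; split=> //.
  by move: a0; rewrite /gen_subalgebra; case: (i j == ord0).
pose o c : 'I_2 := if c then ord0 else lift ord0 ord0.
have oE c : (o c == ord0) = c by case: c.
elim: aB => {b e a} [b a Ba a0|b e a z Ba a0 _ [k [i [u [uB ui i0 <-]]]]].
  exists 0%N, (fun=> o b), (fun=> a); split=> //.
  - by move=> j _; rewrite oE.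
  - by rewrite big_ord_recl big_ord0 mulr1.
exists k.+1, (fun j => if j is j'.+1 then i j' else o b),
  (fun j => if j is j'.+1 then u j' else a); split=> //.
- by case=> [|j] jk; [rewrite oE|exact: uB].
- case=> [_|j jk]; last exact: ui.
  by apply/eqP => oi; move: i0; rewrite -oi oE; case: (b).
- by rewrite [LHS]big_ord_recl.
Qed.

Lemma alternating_free_pair x y :
  (forall b e a, alternating (gen_subalgebra x y) b e a -> phi a = 0) ->
  free_pair phi x y.
Proof.
move=> h k i u k0 uB ui.
suff [e eh] : exists e, alternating (gen_subalgebra x y) (i 0%N == ord0) e
  (\prod_(j < k) u j) by exact: h eh.
have uB' j : (j < k)%N ->
  gen_subalgebra x y (i j == ord0) (u j) /\ phi (u j) = 0.
  by move=> /uB[+ ?]; split=> //; move: a; rewrite /gen_subalgebra;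
    case: (i j == ord0).
case: k k0 uB uB' ui => // k _ _; elim: k i u => [|k ih] i u uB ui.
  rewrite big_ord_recl big_ord0 mulr1; have [? ?] := uB 0%N isT.
  by exists (i 0%N == ord0); apply: alternating1.
have [||e eh] := ih (i \o succn) (u \o succn).
- by move=> j jk; exact: (uB j.+1).
- by move=> j jk; exact: (ui j.+1).
exists e; rewrite big_ord_recl; have [? ?] := uB 0%N isT.
apply: alternatingS => //; move: eh => /=.
suff -> : (i 1%N == ord0) = ~~ (i 0%N == ord0) by [].
have := ui 0%N isT; move: (i 0%N) (i 1%N) => [[|[|//]] ?] [[|[|//]] ?] //=;
  by rewrite -!val_eqE.
Qed.

End alternating.

(** * Freeness implies the Schwinger-Dyson equation *)

Section freeness_to_schwinger_dyson.
Context {R : realType} {A : cstarAlgType R} (phi : {scalar A}).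
Local Notation C := R[i].
Implicit Types (x y z : dpair (A := A)) (k : C) (a u v : A) (b : bool).
Hypothesis phi1 : phi 1 = 1.
Variable g : bool -> A.
Let B b : set A := subalgebra_gen (g b).
Hypothesis gfree : forall b e a, alternating phi B b e a -> phi a = 0.

Let D b : dpair -> Prop := dalg (eq^~ (dgen phi (g b))).

Definition dcenter x := dlin (- phi x.1) dpair1 x.

Lemma dcenterE x : x = dlin (phi x.1) dpair1 (dcenter x).
Proof.
apply: dpair_eq => [|u v] /=; first by rewrite scaleNr addrA subrr add0r.
by rewrite !mulr0 !add0r.
Qed.

Lemma phi_dcenter x : phi (dcenter x).1 = 0.
Proof. by rewrite /= stateD stateZ phi1 mulr1 addrC subrr. Qed.

Lemma dcenter_dalg b x : D b x -> D b (dcenter x).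
Proof. by move=> xD; apply: dalg_lin => //; exact: dalg1. Qed.

Inductive dalternating : bool -> dpair -> Prop :=
| dalternating1 b x : D b x -> phi x.1 = 0 -> dalternating b x
| dalternatingS b x y : D b x -> phi x.1 = 0 -> dalternating (~~ b) y ->
    dalternating b (dmul x y).

(** All polynomials in the two generators lie in this span, as is shown inside
    [free_schwinger_dyson]; the equation being linear, it is enough to check it on 1 and on
    alternating words. *)
Inductive dspan : dpair -> Prop :=
| dspan1 : dspan dpair1
| dspan_alt b x : dalternating b x -> dspan x
| dspan_lin k x y : dspan x -> dspan y -> dspan (dlin k x y).

Lemma D_bilin b x : D b x -> dbilin x.
Proof. by apply: dbilin_dalg => _ ->; exact: dbilin_dgen. Qed.

Lemma dalternating_bilin b x : dalternating b x -> dbilin x.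
Proof. by elim=> {b x} [b x /D_bilin //|b x y /D_bilin xb _ _ yb];
  exact: dbilin_mul. Qed.

Lemma dspan_bilin x : dspan x -> dbilin x.
Proof.
elim=> {x} [|b x|k x y _ xb _ yb]; [exact: dbilin1|exact: dalternating_bilin|].
exact: dbilin_lin.
Qed.

Lemma D_gen b : D b (dgen phi (g b)). Proof. exact: dalg_gen. Qed.

(** A generator either opens a new letter or is absorbed by the first one. Centering that letter
    splits off a multiple of the remaining word, which is again alternating. *)
Lemma dspan_gen_mul b x : dspan x -> dspan (dmul (dgen phi (g b)) x).
Proof.
elim=> {x} [|b' x xa|k x y _ xs _ ys].
- rewrite dmul1 [X in dspan X]dcenterE; apply: dspan_lin; first exact: dspan1.
  apply: (@dspan_alt b); apply: dalternating1; last exact: phi_dcenter.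
  exact/dcenter_dalg/D_gen.
- have [bb|bb] := eqVneq b b'.
    rewrite bb; case: xa => {b' x bb} b' x.
      move=> xD x0; rewrite [X in dspan X]dcenterE.
      apply: dspan_lin; first exact: dspan1.
      apply: (@dspan_alt b'); apply: dalternating1; last exact: phi_dcenter.
      by apply: dcenter_dalg; apply: dalg_mul => //; exact: D_gen.
    move=> y xD x0 ya; rewrite -dmulA [X in dmul X _]dcenterE dlinl; last first.
      exact: dalternating_bilin ya.
    rewrite d1mul; apply: dspan_lin; first exact: dspan_alt ya.
    apply: (@dspan_alt b'); apply: dalternatingS => //; last exact: phi_dcenter.
    by apply: dcenter_dalg; apply: dalg_mul => //; exact: D_gen.
  rewrite [X in dmul X _]dcenterE dlinl; last exact: dalternating_bilin xa.
  rewrite d1mul; apply: dspan_lin; first exact: dspan_alt xa.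
  apply: (@dspan_alt b); apply: dalternatingS => //.
  + exact/dcenter_dalg/D_gen.
  + exact: phi_dcenter.
  + by move: bb xa; case: (b); case: b'.
- rewrite dlinr; last exact: dbilin_dgen.
  exact: dspan_lin.
Qed.

Lemma dalternating_fst b x : dalternating b x -> exists e,
  alternating phi B b e x.1.
Proof.
elim=> {b x} [b x xD x0|b x y xD x0 _ [e ye]].
  by exists b; apply: alternating1 => //; exact: dalg_subalgebra_gen xD.
by exists e; apply: alternatingS => //; exact: dalg_subalgebra_gen xD.
Qed.

Lemma alternating_vanish_r b e u : alternating phi B b e u ->
  forall a, B (~~ e) a -> phi (u * a) = 0.
Proof.
move=> ua a aB; rewrite -(subrK (phi a *: 1) a) mulrDr stateD.
rewrite -scalerAr mulr1 stateZ (gfree ua) mulr0 addr0.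
apply: (@gfree b (~~ e)); apply: alternating_rcons => //.
  exact: subalgebra_gen_center.
exact: phi_center.
Qed.

Lemma alternating_vanish_l b e u : alternating phi B (~~ b) e u ->
  forall a, B b a -> phi (a * u) = 0.
Proof.
move=> ua a aB; rewrite -(subrK (phi a *: 1) a) mulrDl stateD.
rewrite -scalerAl mul1r stateZ (gfree ua) mulr0 addr0.
apply: (@gfree b e); apply: alternatingS => //.
  exact: subalgebra_gen_center.
exact: phi_center.
Qed.

(** Differentiating a letter leaves as left leg the preceding letters times an element of that
    letter's algebra. With [u] in front, these letters form an alternating word ending in the other
    algebra, so [phi] vanishes. *)
Lemma dalternating_vanish b x : dalternating b x -> forall b' u,
  alternating phi B b' (~~ b) u -> x.2 u 1 = 0.
Proof.
elim=> {b x} [b x xD x0|b x y xD x0 ya ih] b' u ua.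
  apply: (dalg_vanish_l xD) => a aB.
  by apply: (alternating_vanish_r ua); rewrite negbK.
rewrite /= mulr1 (dalg_vanish_l xD) ?add0r; last first.
  by move=> a aB; apply: (alternating_vanish_r ua); rewrite negbK.
apply: (ih b'); rewrite negbK -[b in alternating _ _ _ b]negbK.
apply: alternating_rcons => //; rewrite negbK; exact: dalg_subalgebra_gen xD.
Qed.

Variables (m : bool -> C) (n : C).
Hypothesis gE : forall b j, phi (g b ^+ j.+1) = m b * phi (g b ^+ j) +
     n * \sum_(i < j) phi (g b ^+ i) * phi (g b ^+ (j - i)).

Lemma phi_gen b : phi (g b) = m b.
Proof. by have := gE b 0;
  rewrite expr1 expr0 phi1 big_ord0 mulr0 addr0 mulr1. Qed.

(** On an alternating word, only the generator of the first letter's algebra can contribute on the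
    left. A one-letter word reduces to the one-variable equation; for a longer word every term
    vanishes by freeness. *)
Lemma free_schwinger_dyson x :
  dalg (fun y => exists b, y = dgen phi (g b)) x ->
  schwinger_dyson phi (g true + g false) (m true + m false) n x.
Proof.
move=> xG; suff : dspan x.
  elim=> {x xG} [|b x|k x y _ xs _ ys]; last exact: schwinger_dyson_lin.
    by rewrite /schwinger_dyson /= mulr1 stateD !phi_gen phi1 mulr0 addr0 mulr1.
  rewrite /schwinger_dyson.
  have -> : phi ((g true + g false) * x.1) =
      phi (g b * x.1) + phi (g (~~ b) * x.1).
    by rewrite mulrDl stateD; case: b => //; exact: addrC.
  move=> xa; have [e xe] := dalternating_fst xa.
  have -> : phi (g (~~ b) * x.1) = 0.
    have gB := @subalgebra_gen_id _ _ (g (~~ b)).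
    by apply: (@alternating_vanish_l (~~ b) e) gB; rewrite negbK.
  rewrite (gfree xe) mulr0 addr0 add0r.
  case: xa xe => {b x} b x.
    move=> xD x0 _; have := schwinger_dyson_single (gE b) xD.
    by rewrite /schwinger_dyson x0 mulr0 add0r.
  move=> y xD x0 ya _; have [e' ye] := dalternating_fst ya.
  rewrite /= mulrA (alternating_vanish_l ye); last first.
    by apply: subalgebra_genM;
      [exact: subalgebra_gen_id|exact: (dalg_subalgebra_gen xD)].
  rewrite mulr1 mul1r (dalg_vanish_r xD); last first.
    by move=> a aB; apply: (alternating_vanish_l ye).
  rewrite (dalternating_vanish ya (b' := b)) ?addr0 ?mulr0//.
  by rewrite negbK; apply: alternating1 => //; exact: dalg_subalgebra_gen xD.
have : forall y, dspan y -> dspan (dmul x y).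
  have bil z : dalg (fun y => exists b, y = dgen phi (g b)) z -> dbilin z.
    by apply: dbilin_dalg => _ [b ->]; exact: dbilin_dgen.
  elim: xG => {x} [x [b ->]||k x y xG xM yG yM|x y xG xM yG yM] z zs.
  - exact: dspan_gen_mul.
  - by rewrite d1mul.
  - rewrite dlinl; last exact: dspan_bilin.
    by apply: dspan_lin; [exact: xM|exact: yM].
  - by rewrite dmulA; apply: xM; exact: yM.
by move=> /(_ _ dspan1); rewrite dmul1.
Qed.

End freeness_to_schwinger_dyson.

(** * The Schwinger-Dyson equation implies freeness *)

Section schwinger_dyson_to_freeness.
Context {R : realType} {A : cstarAlgType R} (phi : {scalar A}).
Local Notation C := R[i].
Implicit Types (x y z : dpair (A := A)) (k : C) (a u v : A) (b : bool).
Hypothesis phi1 : phi 1 = 1.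
Hypothesis phitr : tracial phi.
Variables (W V : A) (m n : C).
Let dconst a : dpair (A := A) := (a, fun _ _ => 0).
Hypothesis VWsd : forall x,
  dalg (fun y => y = dgen phi V \/ y = dconst W) x ->
  schwinger_dyson phi V m n x.
Let BW : set A := subalgebra_gen W.
Let BV : set A := subalgebra_gen V.
Let DV : dpair -> Prop := dalg (eq^~ (dgen phi V)).
Let DVW : dpair -> Prop := dalg (fun y => y = dgen phi V \/ y = dconst W).

Lemma dconst_dalg a : BW a -> DVW (dconst a).
Proof.
move=> aW; have [x xW <-] := subalgebra_gen_dalg (fun _ _ => 0) aW.
suff -> : dconst x.1 = x by apply: dalg_sub xW => y ->; apply: dalg_gen; right.
apply: dpair_eq => //= u v; apply/esym;
  elim: xW u v => {x} [x ->||k x y _ xh _ yh|x y _ xh _ yh] u v //=.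
  by rewrite xh yh mulr0 addr0.
by rewrite xh yh addr0.
Qed.

(* [altW j x]: [x] is a product [w_0 p_1 w_1 ... p_j w_j] of centered elements
   [w_i] of [BW] and [p_i] of [BV]. *)
Inductive altW : nat -> dpair -> Prop :=
| altW0 w : BW w -> phi w = 0 -> altW 0 (dconst w)
| altWS j w p x : BW w -> phi w = 0 -> DV p -> phi p.1 = 0 -> altW j x ->
    altW j.+1 (dmul (dconst w) (dmul p x)).

Lemma altW_dalg j x : altW j x -> DVW x.
Proof.
elim=> {j x} [w wW _|j w p x wW _ pV _ _ xh]; first exact: dconst_dalg.
apply: dalg_mul; first exact: dconst_dalg.
by apply: dalg_mul => //; apply: dalg_sub pV => y ->; apply: dalg_gen; left.
Qed.

Lemma altW_rcons j x p w : altW j x -> DV p -> phi p.1 = 0 -> BW w ->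
  phi w = 0 ->
  exists2 y, altW j.+1 y & y.1 = x.1 * (p.1 * w).
Proof.
move=> xa pV p0 wW w0;
  elim: xa => {j x} [w' w'W w'0|j w' p' x w'W w'0 p'V p'0 _ [y ya yE]].
  by exists (dmul (dconst w') (dmul p (dconst w))) => //; apply: altWS => //;
    exact: altW0.
exists (dmul (dconst w') (dmul p' y)); first exact: altWS.
by rewrite /= yE !mulrA.
Qed.

Lemma altW_unrcons j x : altW j.+1 x -> exists y p w,
  [/\ altW j y, DV p /\ phi p.1 = 0, BW w /\ phi w = 0 & x.1 = y.1 * (p.1 * w)].
Proof.
elim: j x => [|j ih] x xa.
  inversion xa as [|j' w p y wW w0 pV p0 ya jE xE].
  inversion ya as [w' w'W w'0 jE' yE|].
  by exists (dconst w), p, w'; split=> //; exact: altW0.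
inversion xa as [|j' w p y wW w0 pV p0 ya jE xE].
have [z [p' [w' [za p'V w'W yE]]]] := ih _ ya.
exists (dmul (dconst w) (dmul p z)), p', w'; split=> //; first exact: altWS.
by rewrite /= yE !mulrA.
Qed.

(** As [q] is arbitrary in [BV], this covers words starting in [BW] ([q = 1]) or in [BV], and, since
    [phi] is tracial, those ending in [BV] as well. *)
Let E j := forall x, altW j x -> forall q, BV q -> phi (q * x.1) = 0.

(** Only the letters [p_i] have a derivative. The right leg of such a term is an element of [BV]
    followed by a strictly shorter word, to which [E] applies. *)
Lemma altW_derive0 j x : altW j x -> (forall i, (i < j)%N -> E i) ->
  forall u, x.2 u 1 = 0.
Proof.
elim=> {j x} [//|j w p x wW w0 pV p0 xa ih] hE u; rewrite /= add0r.
rewrite mulr1 (dalg_vanish_r pV) ?add0r; last by move=> a aV; exact: (hE j).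
by apply: ih => i ij; apply: hE; rewrite ltnW.
Qed.

(** Merge [w] with the last letter and center the result. The centered part gives a word of the same
    length; the scalar part removes the last letter, and the exposed [p] is moved next to [q] by the
    trace. When no [p] is left, the scalar part is a multiple of [phi q = 0]. *)
Lemma altW_mul_W j x q w : (forall i, (i <= j)%N -> E i) -> altW j x ->
  BV q -> phi q = 0 -> BW w -> phi (q * (x.1 * w)) = 0.
Proof.
move=> hE xa qV q0 wW; case: j hE xa => [|j] hE xa.
  inversion xa as [w' w'W w'0 jE xE|] => /=.
  rewrite -(subrK (phi (w' * w) *: 1) (w' * w)) mulrDr stateD.
  rewrite -scalerAr mulr1 stateZ q0 mulr0 addr0.
  apply: (hE 0%N isT (dconst _)) => //; apply: altW0;
    last exact: phi_center phi1.
  by apply: subalgebra_gen_center; exact: subalgebra_genM.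
have [y [p [w' [ya [pV p0] [w'W w'0] ->]]]] := altW_unrcons xa.
have [v vE] : exists v, v = w' * w - phi (w' * w) *: 1 by eexists.
have vW : BW v by rewrite vE; apply: subalgebra_gen_center;
  exact: subalgebra_genM.
have v0 : phi v = 0 by rewrite vE; exact: phi_center phi1.
have [c cE] : exists c, c = phi (w' * w) by eexists.
have wE : w' * w = v + c *: 1 by rewrite vE cE subrK.
have -> : q * (y.1 * (p.1 * w') * w) =
    q * (y.1 * (p.1 * v)) + c *: (q * y.1 * p.1).
  by rewrite -!mulrA wE !mulrDr -!scalerAr mulr1.
have [z za <-] := altW_rcons ya pV p0 vW v0.
rewrite stateD stateZ (hE j.+1)// add0r phitr mulrA (hE j)// ?mulr0//.
by apply: subalgebra_genM => //; exact: (dalg_subalgebra_gen pV).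
Qed.

Let dV j := iter j (dmul (dgen phi V)) dpair1.

Lemma dV_fst j : (dV j).1 = V ^+ j.
Proof. by elim: j => [//|j ih]; rewrite exprS -ih. Qed.

Lemma dV_snd0 j v : (forall i, (i <= j)%N -> phi (V ^+ i * v) = 0) ->
  forall u, (dV j).2 u v = 0.
Proof.
elim: j => [//|j ih] vj u /=;
  rewrite -/(dV j) dV_fst mulrA -exprS vj// mulr0 add0r.
by apply: ih => i ij; apply: vj; rewrite ltnW.
Qed.

Lemma dV_dalg j : DV (dV j).
Proof.
elim: j => [|j ih]; first exact: dalg1.
by apply: dalg_mul => //; exact: dalg_gen.
Qed.

(* Induction on [j], then on the power of [V] in front of the word, one factor
   [V] being removed by the Schwinger-Dyson equation. *)
Lemma phi_altW0 j : E j.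
Proof.
have [k jk] := ubnP j; elim: k j jk => // k ihk j jk x xa.
have hE i : (i < j)%N -> E i by move=> ij; apply: ihk; apply: leq_trans ij _;
  rewrite -ltnS.
have Vx l : phi (V ^+ l * x.1) = 0.
  have [k' lk] := ubnP l; elim: k' l lk => // k' ih [_|l lk].
    (* Without a power of [V] in front, the trace carries the first letter to the end, where
       [altW_mul_W] handles it with a shorter word. *)
    rewrite expr0 mul1r; case: xa hE => [//|i w p y wW w0 pV p0 ya] hE /=.
    rewrite phitr -mulrA (@altW_mul_W i)//.
    exact: (dalg_subalgebra_gen pV).
  have /VWsd : DVW (dmul (dV l) x).
    apply: dalg_mul; last exact: altW_dalg xa.
    by apply: dalg_sub (dV_dalg l) => y ->; apply: dalg_gen; left.
  rewrite /schwinger_dyson /= dV_fst mulrA -exprS => ->.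
  rewrite ih// mulr0 add0r mulr1 (altW_derive0 xa)// dV_snd0 ?addr0 ?mulr0//.
  by move=> i il; apply: ih; apply: leq_ltn_trans il _; rewrite -ltnS.
move=> q qV.
suff : forall l, phi (V ^+ l * (q * x.1)) = 0 by move=> /(_ 0%N); rewrite mul1r.
(* Membership in [BV] is used through a predicate that is itself a unital subalgebra; quantifying
   over [z] makes [P] stable under products. *)
pose P q := forall z : A, (forall l, phi (V ^+ l * z) = 0) ->
  forall l, phi (V ^+ l * (q * z)) = 0.
suff : P q by exact.
apply: qV; split; last first.
  move=> _ [->|->] z zh l; last by rewrite mul1r.
  by rewrite mulrA -exprSr.
split.
- by move=> z zh l; rewrite mul1r.
- move=> k' a a' aP a'P z zh l.
  by rewrite mulrDl -scalerAl mulrDr -scalerAr stateD stateZ aP// a'P// mulr0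
    addr0.
- by move=> a a' aP a'P z zh l; rewrite -mulrA aP// => l'; exact: a'P.
Qed.

(** Stripping the [BV] letters at either end leaves an [altW] block, except when the word is a
    single letter of [BV]; hence the extra alternative in the last case. *)
Lemma alternating_altW b e a : alternating phi (gen_subalgebra W V) b e a ->
  let cV p := BV p.1 /\ DV p /\ phi p.1 = 0 in
  if b then
    if e then exists j x, altW j x /\ a = x.1
    else exists j x p, [/\ altW j x, cV p & a = x.1 * p.1]
  else
    if e then exists j x p, [/\ altW j x, cV p & a = p.1 * x.1]
    else (exists j x p p', [/\ altW j x, cV p,
      cV p' & a = p.1 * (x.1 * p'.1)]) \/
         phi a = 0 /\ exists2 p, cV p & a = p.1.
Proof.
move=> ah /=.
have hV q : BV q -> phi q = 0 -> exists p,
  (BV p.1 /\ DV p /\ phi p.1 = 0) /\ q = p.1.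
  by move=> qV q0; have [p pV pE] := subalgebra_gen_dalg (fun u v =>
    phi u * phi (V * v)) qV; exists p; rewrite pE.
elim: ah => {b e a} [[] a aB a0|[] e a x aB a0 _ ih].
- by exists 0%N, (dconst a); split=> //; exact: altW0.
- by right; have [p [pc ->]] := hV a aB a0; split; [case: pc => _ []|exists p].
- move: ih; case: e => /=.
    move=> [j [y [p [ya [pB [pV p0]] ->]]]].
    by exists j.+1, (dmul (dconst a) (dmul p y)); split=> //; exact: altWS.
  move=> [[j [y [p [p' [ya [pB [pV p0]] p'c ->]]]]]|[_ [p pc ->]]].
    exists j.+1, (dmul (dconst a) (dmul p y)), p'; split=> //;
      first exact: altWS.
    by rewrite /= !mulrA.
  by exists 0%N, (dconst a), p; split=> //; exact: altW0.
- have [q [qc ->]] := hV a aB a0; move: ih; case: e => /=.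
    by move=> [j [y [ya ->]]]; exists j, y, q.
  by move=> [j [y [p [ya pc ->]]]]; left; exists j, y, q, p.
Qed.

Lemma schwinger_dyson_free b e a :
  alternating phi (gen_subalgebra W V) b e a -> phi a = 0.
Proof.
move/alternating_altW; case: b; case: e => /=.
- move=> [j [x [xa ->]]]; rewrite -[x.1]mul1r (phi_altW0 xa)//.
  exact: subalgebra_gen1.
- by move=> [j [x [p [xa [pV _] ->]]]]; rewrite phitr (phi_altW0 xa).
- by move=> [j [x [p [xa [pV _] ->]]]]; rewrite (phi_altW0 xa).
- move=> [[j [x [p [p' [xa [pV _] [p'V _] ->]]]]]|[]//].
  by rewrite mulrA phitr mulrA (phi_altW0 xa)//; exact: subalgebra_genM.
Qed.

End schwinger_dyson_to_freeness.

(** * The derivative of the inverse *)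

Lemma geometric_small (R : realType) (K q e : R) : 0 <= q -> q < 1 -> 0 < e ->
  exists N, K * q ^+ N < e.
Proof.
move=> q0 q1 e0.
have : (fun n => K * q ^+ n) @ \oo --> K * 0.
  by apply: cvgM; [exact: cvg_cst|apply: cvg_expr; rewrite ger0_norm].
rewrite mulr0 => /cvgr_lt => /(_ _ e0)[N _ hN].
by exists N; exact: (hN N (leqnn N)).
Qed.

Section approximation.
Context {R : realType} {A : cstarAlgType R} (phi : {scalar A}).
Local Notation C := R[i].
Local Notation nc := Normc.normc.
Implicit Types (x y z : dpair (A := A)) (k : C) (a u v : A) (e K : R).
Hypothesis sphi : state phi.
Variable G : dpair (A := A) -> Prop.

Definition dbounded x := exists2 K, 0 <= K &
  forall u v, nc (x.2 u v) <= K * (cnorm u * cnorm v).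

Definition dclose e x y := cnorm (x.1 - y.1) <= e /\
  forall u v, nc (x.2 u v - y.2 u v) <= e * (cnorm u * cnorm v).

(** Closure of [dalg G] in a graph norm: element and derivative are approximated together.
    Bilinearity and boundedness are recorded because the continuity of products relies on them. *)
Definition dlimit x := [/\ dbilin x, dbounded x &
  forall e, 0 < e -> exists2 y, dalg G y & dclose e x y].

Hypothesis Gbilin : forall x, G x -> dbilin x.
Hypothesis Gbounded : forall x, G x -> dbounded x.

Lemma dbounded1 : dbounded dpair1.
Proof. by exists 0 => // u v;
  rewrite (_ : dpair1.2 u v = 0)// Normc.normc0 mul0r. Qed.

Lemma dbounded_lin k x y : dbounded x -> dbounded y -> dbounded (dlin k x y).
Proof.
move=> [K K0 xK] [L L0 yL]; exists (nc k * K + L) => [|u v].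
  by rewrite addr_ge0// mulr_ge0// normc_ge0.
rewrite /= (le_trans (le_normcD _ _))// Normc.normcM mulrDl lerD//.
by rewrite -mulrA ler_wpM2l// normc_ge0.
Qed.

Lemma dbounded_mul x y : dbounded x -> dbounded y -> dbounded (dmul x y).
Proof.
move=> [K K0 xK] [L L0 yL]; exists (K * cnorm y.1 + L * cnorm x.1) => [|u v].
  by rewrite addr_ge0// mulr_ge0// cnorm_ge0.
rewrite /= (le_trans (le_normcD _ _))// mulrDl lerD//.
  rewrite (le_trans (xK _ _))// -mulrA ler_wpM2l// mulrCA ler_wpM2l
    ?cnorm_ge0//.
  exact: ler_cnormM.
rewrite (le_trans (yL _ _))// -mulrA ler_wpM2l// mulrA ler_wpM2r ?cnorm_ge0//.
by rewrite mulrC ler_cnormM.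
Qed.

Lemma dbounded_dgen a : dbounded (dgen phi a).
Proof.
exists (4 * cnorm a) => [|u v]; first by rewrite mulr_ge0 ?cnorm_ge0.
rewrite /= Normc.normcM.
rewrite (_ : _ * _ * (_ * _) = (2 * cnorm u) * (2 * (cnorm a * cnorm v)));
  last ring.
apply: ler_pM; rewrite ?normc_ge0 ?state_bounded//.
by rewrite (le_trans (state_bounded sphi _))// ler_wpM2l// ler_cnormM.
Qed.

Lemma dlimit_dalg x : dalg G x -> dlimit x.
Proof.
move=> xG; split.
- exact: dbilin_dalg xG.
- elim: xG => {x} [x /Gbounded //||k x y _ ? _ ?|x y _ ? _ ?].
  + exact: dbounded1.
  + exact: dbounded_lin.
  + exact: dbounded_mul.
- move=> e e0; exists x => //; split; first by rewrite subrr cnorm0 ltW.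
  by move=> u v; rewrite subrr Normc.normc0 mulr_ge0 ?mulr_ge0 ?cnorm_ge0// ltW.
Qed.

Lemma dlimit_lin k x y : dlimit x -> dlimit y -> dlimit (dlin k x y).
Proof.
move=> [xb xB xl] [yb yB yl]; split; [exact: dbilin_lin|exact: dbounded_lin|].
move=> e e0; have K0 : 0 < nc k + 1 by rewrite ltr_pwDr// normc_ge0.
have d0 : 0 < e / (nc k + 1) by rewrite divr_gt0.
have [x' x'G [xx1 xx2]] := xl _ d0; have [y' y'G [yy1 yy2]] := yl _ d0.
have eE : e = nc k * (e / (nc k + 1)) + e / (nc k + 1) by field; rewrite gt_eqF.
exists (dlin k x' y'); first exact: dalg_lin.
split=> [|u v] /=.
  rewrite [X in cnorm X](_ : _ = k *: (x.1 - x'.1) + (y.1 - y'.1)); last first.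
    by rewrite scalerBr opprD !addrA; congr (_ - _); rewrite addrAC.
  by rewrite (le_trans
    (ler_cnormD _ _))// cnormZ eE lerD// ler_wpM2l ?normc_ge0.
rewrite [X in nc X](_ : _ = k * (x.2 u v - x'.2 u v) + (y.2 u v - y'.2 u v));
  last ring.
rewrite (le_trans (le_normcD _ _))// Normc.normcM {1}eE mulrDl lerD//.
by rewrite -mulrA ler_wpM2l ?normc_ge0.
Qed.

Lemma dlimit_mul x y : dlimit x -> dlimit y -> dlimit (dmul x y).
Proof.
move=> [xb xB xl] [yb yB yl]; split; [exact: dbilin_mul|exact: dbounded_mul|].
move=> e e0; have [K K0 xK] := xB; have [L L0 yL] := yB.
have [nx0 ny0] := (cnorm_ge0 x.1, cnorm_ge0 y.1).
(* [M] is the total coefficient of [d] in the four estimates [g1] to [g4]; [d <= 1] bounds the norms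
   of the approximants by those of [x.1] and [y.1] plus 1. *)
pose M := cnorm x.1 + cnorm y.1 + K + L + 2.
have M0 : 0 < M by rewrite /M; lra.
pose d := Num.min 1 (e / M).
have d0 : 0 < d by rewrite lt_min ltr01 divr_gt0.
have d1 : d <= 1 by rewrite ge_min lexx.
have dM : d * M <= e by rewrite -ler_pdivlMr// ge_min lexx orbT.
have [x' x'G [xx1 xx2]] := xl _ d0; have [y' y'G [yy1 yy2]] := yl _ d0.
have ny' : cnorm y'.1 <= cnorm y.1 + 1.
  rewrite -(subrK y.1 y'.1) addrC (le_trans (ler_cnormD _ _))// lerD//.
  by rewrite cnormB (le_trans yy1).
have nx' : cnorm x'.1 <= cnorm x.1 + 1.
  rewrite -(subrK x.1 x'.1) addrC (le_trans (ler_cnormD _ _))// lerD//.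
  by rewrite cnormB (le_trans xx1).
exists (dmul x' y'); first exact: dalg_mul.
split=> [|u v].
  rewrite /= [X in cnorm X](_ : _ = x.1 * (y.1 - y'.1) + (x.1 - x'.1) * y'.1);
    last by ncring.
  rewrite (le_trans (ler_cnormD _ _))// (le_trans _ dM)//.
  have h1 := le_trans (ler_cnormM x.1 (y.1 - y'.1)) (ler_wpM2l nx0 yy1).
  have h2 := le_trans (ler_cnormM (x.1 - x'.1) y'.1)
    (ler_pM (cnorm_ge0 _) (cnorm_ge0 _) xx1 ny').
  by rewrite (le_trans (lerD h1 h2))// /M; nra.
have [nu0 nv0] := (cnorm_ge0 u, cnorm_ge0 v).
have xB' w w' : x.2 u (w - w') = x.2 u w - x.2 u w'.
  by rewrite addrC -scaleN1r xb.2 mulN1r addrC.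
have yB' w w' : y.2 (w - w') v = y.2 w v - y.2 w' v.
  by rewrite addrC -scaleN1r yb.1 mulN1r addrC.
have := xx2 u (y'.1 * v); have := xK u ((y.1 - y'.1) * v).
have := yy2 (u * x'.1) v; have := yL (u * (x.1 - x'.1)) v.
rewrite mulrBr mulrBl xB' yB' /= => h1 h2 h3 h4.
rewrite [X in nc X](_ : _ = (x.2 u (y.1 * v) - x.2 u (y'.1 * v)) +
    (x.2 u (y'.1 * v) - x'.2 u (y'.1 * v)) +
  ((y.2 (u * x.1) v - y.2 (u * x'.1) v) +
    (y.2 (u * x'.1) v - y'.2 (u * x'.1) v))); last ring.
have g1 : nc (y.2 (u * x.1) v - y.2 (u * x'.1) v) <= L * d *
  (cnorm u * cnorm v).
  rewrite (le_trans h1)// -mulrA ler_wpM2l// mulrA ler_wpM2r// mulrC -mulrBr.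
  by rewrite (le_trans (ler_cnormM _ _))// ler_wpM2l.
have g2 : nc (y.2 (u * x'.1) v - y'.2 (u * x'.1) v) <=
    d * (cnorm x.1 + 1) * (cnorm u * cnorm v).
  rewrite (le_trans h2)// -mulrA ler_wpM2l ?(ltW d0)// mulrA ler_wpM2r// mulrC.
  by rewrite (le_trans (ler_cnormM _ _))// ler_wpM2l.
have g3 : nc (x.2 u (y.1 * v) - x.2 u (y'.1 * v)) <= K * d *
  (cnorm u * cnorm v).
  rewrite (le_trans h3)// -mulrA ler_wpM2l// mulrCA ler_wpM2l// -mulrBl.
  by rewrite (le_trans (ler_cnormM _ _))// ler_wpM2r.
have g4 : nc (x.2 u (y'.1 * v) - x'.2 u (y'.1 * v)) <=
    d * (cnorm y.1 + 1) * (cnorm u * cnorm v).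
  rewrite (le_trans h4)// -mulrA ler_wpM2l ?(ltW d0)// mulrCA ler_wpM2l//.
  by rewrite (le_trans (ler_cnormM _ _))// ler_wpM2r.
apply: (@le_trans _ _ (d * M * (cnorm u * cnorm v))); last first.
  by rewrite ler_wpM2r// mulr_ge0.
rewrite (le_trans (le_normcD _ _))//.
rewrite (le_trans (lerD (le_normcD _ _) (le_normcD _ _)))//.
rewrite (le_trans (lerD (lerD g3 g4) (lerD g1 g2)))// -!mulrDl.
by rewrite ler_wpM2r ?mulr_ge0// /M; lra.
Qed.

Lemma dlimit_schwinger_dyson a m n x : dlimit x ->
  (forall y, dalg G y -> schwinger_dyson phi a m n y) ->
  schwinger_dyson phi a m n x.
Proof.
move=> [_ _ xl] hsd; rewrite /schwinger_dyson.
set l := LHS; set r := RHS.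
have : l - r = 0; last by move/eqP; rewrite subr_eq0 => /eqP.
pose M := 2 * cnorm a + nc m * 2 + nc n + 1.
have na0 := cnorm_ge0 a; have nm0 := normc_ge0 m; have nn0 := normc_ge0 n.
have M0 : 0 < M by rewrite /M; lra.
apply: Normc.eq0_normc; apply/eqP; rewrite eq_le normc_ge0 andbT.
apply/ler_addgt0Pl => e e0; rewrite addr0.
have [y /hsd ysd [y1 y2]] := xl _ (divr_gt0 e0 M0).
have -> : l - r = phi (a * (x.1 - y.1)) - m * phi (x.1 - y.1) - n *
  (x.2 1 1 - y.2 1 1).
  by rewrite /l /r mulrBr !stateB ysd; ring.
have h1 : nc (phi (a * (x.1 - y.1))) <= 2 * (cnorm a * (e / M)).
  rewrite (le_trans (state_bounded sphi _))// ler_wpM2l//.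
  by rewrite (le_trans (ler_cnormM _ _))// ler_wpM2l.
have h2 : nc (m * phi (x.1 - y.1)) <= nc m * (2 * (e / M)).
  rewrite Normc.normcM ler_wpM2l// (le_trans (state_bounded sphi _))//.
  by rewrite ler_wpM2l.
have h3 : nc (n * (x.2 1 1 - y.2 1 1)) <= nc n * (e / M).
  rewrite Normc.normcM ler_wpM2l// (le_trans (y2 _ _))//.
  by rewrite cnorm1 !mulr1.
rewrite (le_trans (le_normcD _ _))// normcN.
rewrite (le_trans (lerD (le_normcD _ _) (lexx _)))// normcN.
rewrite (le_trans (lerD (lerD h1 h2) h3))//.
have -> : 2 * (cnorm a * (e / M)) + nc m * (2 * (e / M)) + nc n * (e / M) =
  (M - 1) * (e / M) by rewrite /M; ring.
by rewrite mulrBl mul1r mulrCA mulfV ?gt_eqF// mulr1 gerBl divr_ge0 ?(ltW e0)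
  ?(ltW M0).
Qed.

Variables (V T : A) (c : R).
Hypothesis c0 : 0 < c.
Hypothesis VT : V * T = 1.
Let Z := 1 - c^-1%:C%C *: V.
Hypothesis Z1 : cnorm Z < 1.
Hypothesis GV : dalg G (dgen phi V).

(* [D V = 1 (x) V] forces [D T = - T * D V * T = - T (x) 1]. *)
Definition dinv : dpair (A := A) := (T, fun u v => - (phi (u * T) * phi v)).

Let dZ := dlin (- c^-1%:C%C) (dgen phi V) dpair1.
(** Partial Neumann sums for [T]: the iteration [y |-> c^-1 + Z y], whose fixed point is [T],
    started at zero, which is written as [1 - 1] to stay in [dalg G]. *)
Let t N := iter N (fun y =>
  dlin c^-1%:C%C dpair1 (dmul dZ y)) (dlin (- 1) dpair1 dpair1).

Let t_dalg N : dalg G (t N).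
Proof.
elim: N => [|N ih] /=; first by apply: dalg_lin; exact: dalg1.
apply: dalg_lin; first exact: dalg1.
by apply: dalg_mul => //; apply: dalg_lin => //; exact: dalg1.
Qed.

Let TE : T = c^-1%:C%C *: 1 + Z * T.
Proof. by rewrite /Z mulrBl mul1r -scalerAl VT addrC subrK. Qed.

Let dZ1 : dZ.1 = Z.
Proof. by rewrite /dZ /Z /= scaleNr addrC. Qed.

Let t_fst N : T - (t N).1 = Z ^+ N * T.
Proof.
elim: N => [|N ih].
  by rewrite /= scaleN1r addNr subr0 expr0 mul1r.
rewrite exprS -mulrA -ih mulrBr [in LHS]TE /= -/(t N) -[- _ *: V + 1]/(dZ.1)
  dZ1.
by rewrite opprD addrACA subrr add0r.
Qed.

Let q := cnorm Z.
(** The error of the derivatives obeys [e (N + 1) <= q e N + C q^N], which allows growth like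
    [N q^N]. A ratio strictly between [q] and 1 absorbs the factor [N], and dividing by [q' - q]
    makes [K q'^N] a supersolution. *)
Let q' := (1 + q) / 2.
Let K := (4 * cnorm T * (c^-1 * cnorm V + 1)) / (q' - q).

Let t_snd N u v :
  nc (dinv.2 u v - (t N).2 u v) <= K * q' ^+ N * (cnorm u * cnorm v).
Proof.
have q0 : 0 <= q := cnorm_ge0 _.
have qq' : 0 < q' - q by rewrite /q'; move: Z1; rewrite -/q; lra.
have q'1 : q' < 1 by rewrite /q'; move: Z1; rewrite -/q; lra.
have q'0 : 0 <= q' by rewrite divr_ge0 ?addr_ge0.
have [T0 V0] := (cnorm_ge0 T, cnorm_ge0 V).
have cV : 0 <= c^-1 * cnorm V by rewrite mulr_ge0// invr_ge0 ltW.
have phib w := state_bounded sphi w.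
have KE : K * (q' - q) = 4 * cnorm T * (c^-1 * cnorm V + 1).
  by rewrite /K mulfVK// gt_eqF.
have K0 : 0 <= K by rewrite /K divr_ge0 ?(ltW qq')// mulr_ge0 ?addr_ge0//
  mulr_ge0.
have phi2 w w' : nc (phi w * phi w') <= 4 * (cnorm w * cnorm w').
  rewrite Normc.normcM (_ : 4 * _ = (2 * cnorm w) * (2 * cnorm w')); last ring.
  by rewrite ler_pM// normc_ge0.
elim: N u v => [|N ih] u v.
  rewrite /= mulr0 addr0 subr0 normcN expr0 mulr1.
  rewrite (le_trans (phi2 _ _))//.
  apply: (@le_trans _ _ (4 * (cnorm u * cnorm T * cnorm v))).
    by rewrite ler_wpM2l// ler_wpM2r ?cnorm_ge0// ler_cnormM.
  rewrite (_ : 4 * _ = 4 * cnorm T * (cnorm u * cnorm v)); last ring.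
  rewrite ler_wpM2r ?mulr_ge0 ?cnorm_ge0//.
  have : K * (q' - q) <= K.
    by rewrite ler_piMr// lerBlDr ltW// (lt_le_trans q'1)// lerDl.
  rewrite KE; apply: le_trans; rewrite mulrDr mulr1 lerDr.
  by rewrite mulr_ge0// mulr_ge0.
have -> : dinv.2 u v - (t N.+1).2 u v =
    (dinv.2 (u * Z) v - (t N).2 (u * Z) v) -
    c^-1%:C%C * (phi u * phi (V * (Z ^+ N * T) * v)).
  have uT : phi (u * T) = c^-1%:C%C * phi u + phi (u * Z * T).
    by rewrite {1}TE mulrDr -scalerAr mulr1 mulrA stateD stateZ.
  have vE : V * (Z ^+ N * T) * v = v - V * ((t N).1 * v).
    by rewrite -t_fst (mulrBr V T (t N).1) VT mulrBl mul1r mulrA.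
  have tS : (t N.+1).2 u v =
      - c^-1%:C%C * (phi u * phi (V * ((t N).1 * v))) + (t N).2 (u * Z) v.
    by rewrite -dZ1 /= mulr0 add0r addr0.
  by rewrite tS vE stateB /dinv /= uT; ring.
rewrite (le_trans (le_normcD _ _))// normcN Normc.normcM normc_real.
rewrite ger0_norm ?invr_ge0 ?(ltW c0)//.
apply: (@le_trans _ _ (K * q' ^+ N * (q * (cnorm u * cnorm v)) +
   4 * (c^-1 * cnorm V) * cnorm T * q' ^+ N * (cnorm u * cnorm v))).
  apply: lerD.
    rewrite (le_trans (ih _ _))// ler_wpM2l ?(mulr_ge0 K0 (exprn_ge0 N q'0))//.
    rewrite mulrA (mulrC q) ler_wpM2r ?cnorm_ge0//.
    exact: ler_cnormM.
  have -> : 4 * (c^-1 * cnorm V) * cnorm T * q' ^+ N * (cnorm u * cnorm v) =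
    c^-1 * (4 * (cnorm u * (cnorm V * (q' ^+ N * cnorm T) * cnorm v))) by ring.
  rewrite ler_wpM2l ?invr_ge0 ?(ltW c0)// (le_trans (phi2 _ _))// ler_wpM2l//.
  rewrite ler_wpM2l ?cnorm_ge0// (le_trans
    (ler_cnormM _ _))// ler_wpM2r ?cnorm_ge0//.
  rewrite (le_trans (ler_cnormM _ _))// ler_wpM2l ?cnorm_ge0//.
  rewrite (le_trans (ler_cnormM _ _))// ler_wpM2r ?cnorm_ge0//.
  by rewrite (le_trans (cnormX_le _ _))// lerXn2r ?nnegrE// ltW// -subr_gt0.
rewrite mulrA -mulrDl ler_wpM2r ?mulr_ge0 ?cnorm_ge0// exprS.
have -> : K * q' ^+ N * q + 4 * (c^-1 * cnorm V) * cnorm T * q' ^+ N =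
  (K * q + 4 * (c^-1 * cnorm V) * cnorm T) * q' ^+ N by ring.
rewrite [X in _ <= X]mulrA ler_wpM2r ?(exprn_ge0 N q'0)//.
move: KE T0; lra.
Qed.

Lemma dlimit_inv : dlimit dinv.
Proof.
have q0 : 0 <= q := cnorm_ge0 _.
have q1 : q < 1 by [].
have q'1 : q' < 1 by rewrite /q'; lra.
have q'0 : 0 <= q' by rewrite /q'; lra.
have qq' : q <= q' by rewrite /q'; lra.
split.
- split=> * /=; first by rewrite mulrDl -scalerAl stateD stateZ; ring.
  by rewrite stateD stateZ; ring.
- exists (4 * cnorm T) => [|u v]; first by rewrite mulr_ge0 ?cnorm_ge0.
  rewrite /= normcN Normc.normcM.
  rewrite (_ : _ * _ * (_ * _) = (2 * (cnorm u * cnorm T)) * (2 * cnorm v));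
    last ring.
  apply: ler_pM; rewrite ?normc_ge0 ?state_bounded//.
  by rewrite (le_trans (state_bounded sphi _))// ler_wpM2l// ler_cnormM.
- move=> e e0.
  have [N hN] := geometric_small (`|K| + cnorm T) q'0 q'1 e0.
  have qN : 0 <= q' ^+ N by rewrite exprn_ge0.
  exists (t N); [exact: t_dalg|split].
    rewrite t_fst (le_trans (ler_cnormM _ _))// (le_trans _ (ltW hN))// mulrC.
    rewrite ler_pM ?cnorm_ge0 ?lerDr// (le_trans (cnormX_le _ _))//.
    by rewrite lerXn2r ?nnegrE.
  move=> u v; rewrite (le_trans
    (t_snd _ _ _))// ler_wpM2r ?mulr_ge0 ?cnorm_ge0//.
  rewrite (le_trans _ (ltW hN))// ler_wpM2r// (le_trans (ler_norm _))// lerDl.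
  exact: cnorm_ge0.
Qed.

End approximation.

(** * Invertibility of the sum *)

Section convolution.
Context {R : realFieldType}.
Implicit Types u v : nat -> R.

Lemma sum_convolution u v N :
  \sum_(k < N) \sum_(i < k.+1) u i * v (k - i)%N =
  \sum_(i < N) u i * \sum_(j < N - i) v j.
Proof.
elim: N => [|N ih]; first by rewrite !big_ord0.
rewrite big_ord_recr/= ih [in RHS]big_ord_recr/= subSnn [\sum_(j < 1)
  _]big_ord1.
rewrite [\sum_(i < N.+1) u i * v _]big_ord_recr/= subnn addrA; congr (_ + _);
  rewrite -big_split/=.
apply: eq_bigr => i _; rewrite -mulrDr subSn ?(ltnW (ltn_ord i))//.
by rewrite big_ord_recr.
Qed.

Lemma sum_convolution_le u v N : (forall i, 0 <= u i) -> (forall i, 0 <= v i) ->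
  \sum_(k < N) \sum_(i < k.+1) u i * v (k - i)%N <=
  (\sum_(i < N) u i) * \sum_(j < N) v j.
Proof.
move=> u0 v0; rewrite sum_convolution mulr_suml; apply: ler_sum => i _.
rewrite ler_wpM2l// -[in X in _ <= X](subnK (ltnW (ltn_ord i))).
by rewrite big_split_ord/= lerDl sumr_ge0.
Qed.

(* [2 M] is the double fixed point of [s |-> M + s^2 / (4 M)]. *)
Lemma catalan_sum_le u M N : 0 < M -> (forall i, 0 <= u i) -> u 0%N <= M ->
  (forall n, u n.+1 <= (4 * M)^-1 * \sum_(i < n) u i * u (n - i.+1)%N) ->
  \sum_(i < N) u i <= 2 * M.
Proof.
move=> M0 u0 uM uS; elim: N => [|N ih];
  first by rewrite big_ord0 mulr_ge0// ltW.
apply: (@le_trans _ _ (\sum_(i < N.+2) u i)).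
  by rewrite [X in _ <= X]big_ord_recr/= lerDl.
rewrite 2!big_ord_recl/=.
have u1 : u 1%N <= 0 by rewrite (le_trans (uS 0%N))// big_ord0 mulr0.
have : \sum_(i < N) u (bump 0 (bump 0 i)) <= (4 * M)^-1 * (2 * M) ^+ 2.
  have S0 : 0 <= \sum_(i < N) u i by rewrite sumr_ge0.
  apply: (@le_trans _ _ ((4 * M)^-1 * ((\sum_(i < N) u i) * \sum_(i < N) u i))).
    apply: le_trans (ler_wpM2l _ (sum_convolution_le N u0 u0)); last first.
      by rewrite invr_ge0 mulr_ge0// ltW.
    by rewrite mulr_sumr; apply: ler_sum => i _; exact: uS.
  by rewrite ler_wpM2l ?invr_ge0 ?mulr_ge0 ?(ltW M0)// expr2 ler_pM.
have -> : (4 * M)^-1 * (2 * M) ^+ 2 = M by field; rewrite gt_eqF.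
by rewrite /bump/=; move: u1 uM; lra.
Qed.

(** Summed over [n], the inequality bounds each partial sum of [v] by 2 plus [theta] times the
    previous one; [2 / (1 - theta)] is the fixed point. *)
Lemma renewal_le u v M theta N : 0 < M -> 0 <= theta < 1 ->
  (forall i, 0 <= u i) -> (forall i, 0 <= v i) ->
  (forall n, \sum_(i < n) u i <= 2 * M) ->
  (forall n, v n <= u n / M +
     theta / (2 * M) * \sum_(i < n) v i * u (n - i.+1)%N) ->
  v N <= 2 / (1 - theta).
Proof.
move=> M0 /andP[t0 t1] u0 v0 uM vS.
have t2 : 0 < 1 - theta by rewrite subr_gt0.
suff h n : \sum_(i < n) v i <= 2 / (1 - theta).
  by apply: le_trans (h N.+1); rewrite big_ord_recr/= lerDr sumr_ge0.
elim: n => [|n ih]; first by rewrite big_ord0 divr_ge0// ltW.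
apply: (@le_trans _ _ (2 + theta * (2 / (1 - theta)))); last first.
  by rewrite le_eqVlt; apply/orP; left; apply/eqP; field; rewrite gt_eqF.
apply: (@le_trans _ _ (\sum_(i < n.+1) (u i / M +
    theta / (2 * M) * \sum_(j < i) v j * u (i - j.+1)%N))).
  by apply: ler_sum => i _; exact: vS.
rewrite big_split/= -mulr_suml -mulr_sumr lerD//.
  by rewrite ler_pdivrMr// uM.
rewrite big_ord_recl/= big_ord0 add0r.
apply: (@le_trans _ _ (theta / (2 * M) * ((2 / (1 - theta)) * (2 * M))));
  last first.
  by rewrite le_eqVlt; apply/orP; left; apply/eqP; field; rewrite !gt_eqF.
rewrite ler_wpM2l ?divr_ge0 ?mulr_ge0 ?(ltW M0)//.
apply: (le_trans (sum_convolution_le n v0 u0)).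
by rewrite ler_pM// ?sumr_ge0.
Qed.

End convolution.

(** * Geometric decay of the moments of [Z] *)

Section moments.
Context {R : realType} {A : cstarAlgType R} (phi : {scalar A}).
Local Notation C := R[i].
Local Notation nc := Normc.normc.
Hypothesis sphi : state phi.
Variables (V : A) (alpha m : R).
Hypothesis alpha0 : 0 < alpha.
Hypothesis m1 : 1 < m.
Hypothesis Vsd : forall x, dalg (eq^~ (dgen phi V)) x ->
  schwinger_dyson phi V (alpha * m)%:C%C alpha%:C%C x.

Variables (c : R) (Z : A).
Hypothesis cE : c = alpha * (1 + m).
Hypothesis ZE : Z = 1 - c^-1%:C%C *: V.
Let h n := phi (V * Z ^+ n).
Let t n := phi (Z ^+ n).

Let c0 : 0 < c.
Proof. by rewrite cE mulr_gt0// addr_gt0// (lt_trans _ m1). Qed.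

Let dZ := dlin (- c^-1%:C%C) (dgen phi V) dpair1.
Let dZn n := iter n (dmul dZ) dpair1.

Let dZ1 : dZ.1 = Z.
Proof. by rewrite /dZ ZE /= scaleNr addrC. Qed.

Let dZn_fst n : (dZn n).1 = Z ^+ n.
Proof. by elim: n => [//|n ih]; rewrite exprS -ih -dZ1. Qed.

Let dZn_snd n u v : (dZn n).2 u v =
  - c^-1%:C%C * \sum_(i < n) phi (u * Z ^+ i) * phi (V * Z ^+ (n - i.+1) * v).
Proof.
elim: n u v => [|n ih] u v; first by rewrite big_ord0 mulr0.
have -> : (dZn n.+1).2 u v = - c^-1%:C%C * (phi u * phi (V * (Z ^+ n * v))) +
    (dZn n).2 (u * Z) v.
  by rewrite -dZn_fst -dZ1 /= addr0.
rewrite ih big_ord_recl [RHS]mulrDr; congr (_ + _).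
  by rewrite /= expr0 mulr1 subn1 mulrA.
by congr (_ * _); apply: eq_bigr => i _; rewrite exprS mulrA.
Qed.

Let dZn_dalg n : dalg (eq^~ (dgen phi V)) (dZn n).
Proof.
elim: n => [|n ih] /=; first exact: dalg1.
by apply: dalg_mul => //; apply: dalg_lin; [exact: dalg_gen|exact: dalg1].
Qed.

Let hE n : h n = (alpha * m)%:C%C * t n -
  (alpha / c)%:C%C * \sum_(i < n) t i * h (n - i.+1).
Proof.
have := Vsd (dZn_dalg n); rewrite /schwinger_dyson dZn_snd dZn_fst => h'.
rewrite /h h' /t; congr (_ + _); rewrite rmorphM /= mulNr mulrN mulrA;
  congr (- (_ * _)).
by apply: eq_bigr => i _; rewrite mul1r mulr1.
Qed.

Let tS n : t n.+1 = t n - c^-1%:C%C * h n.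
Proof. by rewrite /t exprS {1}ZE mulrBl mul1r -scalerAl stateB stateZ. Qed.

Let t0 : t 0 = 1.
Proof. by rewrite /t expr0; case: sphi. Qed.

(** The value [c = alpha (1 + m)] is the one for which the terms linear in [h n] cancel, leaving a
    purely quadratic recurrence. *)
Let hS n : h n.+1 = (alpha / c ^+ 2)%:C%C * \sum_(i < n) h i * h (n - i.+1).
Proof.
have -> : \sum_(i < n) h i * h (n - i.+1) =
    c%:C%C * (\sum_(i < n) t i * h (n - i.+1) - \sum_(i < n) t i.+1 * h
      (n - i.+1)).
  rewrite -sumrB mulr_sumr; apply: eq_bigr => i _.
  rewrite tS -mulrBl opprB addrC subrK mulrA; congr (_ * _).
  by rewrite mulrA -rmorphM mulfV ?gt_eqF// mul1r.
rewrite hE big_ord_recl/= subn1/= t0 mul1r tS.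
have -> : \sum_(i < n) t (bump 0 i) * h (n.+1 - (bump 0 i).+1) =
  \sum_(i < n) t i.+1 * h (n - i.+1) by [].
have := hE n; set s := \sum_(i < n) _; set s' := \sum_(i < n) _ => hn.
have cC : c%:C%C != 0
  by rewrite -(rmorph0 (real_complex R)) (inj_eq (@complexI _)) gt_eqF.
have ccE : c%:C%C = alpha%:C%C * (1 + m%:C%C) by rewrite cE rmorphM rmorphD.
have -> : (alpha / c ^+ 2)%:C%C = alpha%:C%C / c%:C%C ^+ 2.
  by rewrite rmorphM fmorphV rmorphXn.
move: hn; have -> : (alpha / c)%:C%C = alpha%:C%C / c%:C%C.
  by rewrite rmorphM fmorphV.
have -> : c^-1%:C%C = (c%:C%C)^-1 by rewrite fmorphV.
rewrite rmorphM => hn.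
have hn' : alpha%:C%C * m%:C%C * t n = h n + alpha%:C%C / c%:C%C * s.
  by rewrite hn subrK.
rewrite mulrBr hn'.
apply: (mulfI cC).
have a1 : c%:C%C * h n = alpha%:C%C * (1 + m%:C%C) * h n by rewrite -ccE.
have -> : c%:C%C * (h n + alpha%:C%C / c%:C%C * s -
   alpha%:C%C * m%:C%C * ((c%:C%C)^-1 * h n) - alpha%:C%C / c%:C%C *
     (h n + s')) =
   c%:C%C * h n + alpha%:C%C * (s - s') - alpha%:C%C * (1 + m%:C%C) * h n.
  by field.
rewrite a1; field; exact: cC.
Qed.

Lemma normc_sum n (F : nat ->
  C) : nc (\sum_(i < n) F i) <= \sum_(i < n) nc (F i).
Proof.
elim: n => [|n ih]; first by rewrite !big_ord0 Normc.normc0.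
by rewrite !big_ord_recr/= (le_trans (le_normcD _ _))// lerD2r.
Qed.

Let s0 : 0 < Num.sqrt m.
Proof. by rewrite sqrtr_gt0 (lt_trans _ m1). Qed.

Let ss : Num.sqrt m ^+ 2 = m.
Proof. by rewrite sqr_sqrtr// ltW// (lt_trans _ m1). Qed.

Lemma moments_geometric_bound :
  exists B q, [/\ 0 <= q, q < 1 & forall n, nc (phi (Z ^+ n)) <= B * q ^+ n].
Proof.
(* With this rescaling, [alpha x^2 / c^2 = 1 / (4 alpha m)], the coefficient required by
   [catalan_sum_le] for [M = alpha m], which is also the value of [h 0]. *)
have [x xE] : exists x, x = c / (2 * alpha * Num.sqrt m) by eexists.
have x0 : 0 < x by rewrite xE divr_gt0// !mulr_gt0.
have m0 : 0 < m by exact: lt_trans m1.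
have M0 : 0 < alpha * m by exact: mulr_gt0.
have s1 : 1 < Num.sqrt m
  by rewrite -(ltr_pXn2r (n := 2)) ?nnegrE ?(ltW s0)// ss expr1n.
pose u n := nc (h n) * x ^+ n; pose v n := nc (t n) * x ^+ n.
have u0 n : 0 <= u n by rewrite mulr_ge0 ?normc_ge0 ?exprn_ge0 ?ltW.
have v0 n : 0 <= v n by rewrite mulr_ge0 ?normc_ge0 ?exprn_ge0 ?ltW.
have uM n : \sum_(i < n) u i <= 2 * (alpha * m).
  apply: catalan_sum_le => // [|k].
    rewrite /u expr0 mulr1 hE big_ord0 mulr0 subr0 t0 mulr1 normc_real.
    by rewrite ger0_norm// ltW.
  rewrite /u hS Normc.normcM normc_real ger0_norm; last first.
    by rewrite divr_ge0 ?exprn_ge0// ltW.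
  have -> : (4 * (alpha * m))^-1 = alpha / c ^+ 2 * x ^+ 2.
    rewrite xE cE expr_div_n !exprMn ss; field.
    by rewrite !gt_eqF ?addr_gt0.
  rewrite -[X in X <= _]mulrA -[X in _ <= X]mulrA.
  rewrite ler_wpM2l ?divr_ge0 ?exprn_ge0 ?(ltW alpha0) ?(ltW c0)//.
  apply: le_trans (ler_wpM2r _ (normc_sum k (fun i => h i * h (k - i.+1)))) _.
    by rewrite exprn_ge0// ltW.
  rewrite mulr_sumr mulr_suml; apply: ler_sum => i _; rewrite Normc.normcM.
  rewrite le_eqVlt; apply/orP; left; apply/eqP.
  have -> : x ^+ k.+1 = x ^+ 2 * (x ^+ i * x ^+ (k - i.+1)).
    by rewrite -!exprD -[k in LHS](subnKC (ltn_ord i)).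
  ring.
(* Twice [alpha x / c], where [alpha x / c] is the weight of the convolution in the rescaled
   equation for [t]; it is below 1 because [1 < m]. *)
pose theta := (Num.sqrt m)^-1.
have th : 0 <= theta < 1 by rewrite invr_ge0 (ltW s0) invf_lt1.
have vM n : v n <= 2 / (1 - theta).
  apply: (renewal_le _ M0 th u0 v0 uM) => k.
  have tE : (alpha * m)%:C%C * t k = h k +
      (alpha / c)%:C%C * \sum_(i < k) t i * h (k - i.+1) by rewrite hE subrK.
  rewrite -(ler_pM2l M0) mulrDr (mulrC _ (u k / _)) divfK ?gt_eqF//.
  have -> : alpha * m * v k = nc ((alpha * m)%:C%C * t k) * x ^+ k.
    by rewrite Normc.normcM normc_real ger0_norm ?(ltW M0)// mulrA.
  have xk : 0 <= x ^+ k by rewrite exprn_ge0// ltW.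
  rewrite tE (le_trans (ler_wpM2r xk (le_normcD _ _)))// mulrDl lerD//.
  rewrite Normc.normcM normc_real ger0_norm ?divr_ge0 ?(ltW c0) ?(ltW alpha0)//.
  have -> : alpha * m * (theta / (2 * (alpha * m)) * \sum_(i < k) v i * u
    (k - i.+1)%N) =
     alpha / c * (x * \sum_(i < k) v i * u (k - i.+1)%N).
    by rewrite /theta xE; field; rewrite !gt_eqF.
  rewrite -[X in X <= _]mulrA ler_wpM2l ?divr_ge0 ?(ltW alpha0) ?(ltW c0)//.
  apply: le_trans (ler_wpM2r xk (normc_sum k (fun i => t i * h (k - i.+1)))) _.
  rewrite mulr_sumr mulr_suml; apply: ler_sum => i _; rewrite Normc.normcM.
  rewrite le_eqVlt; apply/orP; left; apply/eqP.
  have -> : x ^+ k = x * (x ^+ i * x ^+ (k - i.+1)).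
    by rewrite mulrA -exprS -exprD subnKC.
  by rewrite /v /u; ring.
(* This is [2 sqrt m < 1 + m], that is, [(sqrt m - 1)^2 > 0]. *)
have x1 : 1 < x.
  rewrite xE ltr_pdivlMr ?mulr_gt0// mul1r cE -mulrA mulrCA ltr_pM2l// -{2}ss.
  by have := sqr_ge0 (Num.sqrt m - 1); nra.
exists (2 / (1 - theta)), x^-1; split.
- by rewrite invr_ge0 ltW.
- by rewrite invf_lt1.
- by move=> n; rewrite exprVn ler_pdivlMr ?exprn_gt0//; exact: vM.
Qed.

Hypothesis fphi : faithful phi.
Hypothesis Vsa : selfadjoint V.

Lemma cnorm_free_poisson_sum : cnorm Z < 1.
Proof.
have [B [q [q0 q1 hB]]] := moments_geometric_bound.
have Zsa : selfadjoint Z.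
  by rewrite ZE; apply: selfadjointB; [exact: star1|exact: selfadjointZ].
have q2 : q ^+ 2 < 1 by rewrite exprn_ilt1.
pose s := (q ^+ 2 + 1) / 2.
have s1 : s < 1 by rewrite /s; lra.
have hs : cnorm Z ^+ 2 <= s.
  apply: (cnorm_le_of_moments sphi fphi (C := B) Zsa q0) => //.
  by rewrite /s; lra.
by have := le_lt_trans hs s1; rewrite expr_lt1// cnorm_ge0.
Qed.

Lemma free_poisson_sum_inv_sqrt : exists w, is_inv_sqrt V w.
Proof.
have csa : selfadjoint (c%:C%C *: 1 - V).
  by apply: selfadjointB => //; apply: selfadjointZ; exact: star1.
have [|w] := exists_inv_sqrt c0 csa.
  have -> : c%:C%C *: 1 - V = c%:C%C *: Z.
    by rewrite ZE scalerBr scaleri mulfV ?gt_eqF// scale1r.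
  rewrite cnormZr ger0_norm ?(ltW c0)// -[X in _ < X]mulr1 ltr_pM2l//.
  exact: cnorm_free_poisson_sum.
by rewrite opprB addrC subrK => ?; exists w.
Qed.

End moments.

(** * Moments of the free Poisson distribution *)

Section derive_rules.
Context {R : realType}.
Implicit Types (f g : R -> R) (x a b k : R).

Lemma is_derive_addfun f g x a b : is_derive x 1 f a -> is_derive x 1 g b ->
  is_derive x 1 (fun t => f t + g t) (a + b).
Proof. exact: is_deriveD. Qed.

Lemma is_derive_subfun f g x a b : is_derive x 1 f a -> is_derive x 1 g b ->
  is_derive x 1 (fun t => f t - g t) (a - b).
Proof. exact: is_deriveB. Qed.

Lemma is_derive_mulfun f g x a b : is_derive x 1 f a -> is_derive x 1 g b ->
  is_derive x 1 (fun t => f t * g t) (f x * b + g x * a).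
Proof. exact: is_deriveM. Qed.

Lemma is_derive_invfun f x a : f x != 0 -> is_derive x 1 f a ->
  is_derive x 1 (fun t => (f t)^-1) (- (f x) ^- 2 * a).
Proof. by move=> fx fa; exact: (is_deriveV fx). Qed.

Lemma is_derive_subc x k : is_derive x 1 (fun t => t - k) 1.
Proof.
rewrite -[X in is_derive _ _ _ X]subr0.
exact: (is_derive_subfun (is_derive_id x 1) (is_derive_cst k x 1)).
Qed.

Lemma is_derive_expfun n x : is_derive x 1 (fun t => t ^+ n) (n%:R * x ^+ n.-1).
Proof.
elim: n => [|n ih].
  by rewrite mul0r; under eq_fun do rewrite expr0; exact: is_derive_cst.
under eq_fun do rewrite exprS.
have := is_derive_mulfun (is_derive_id x 1) ih.
suff -> : x * (n%:R * x ^+ n.-1) + x ^+ n * 1 = n.+1%:R * x ^+ n.+1.-1 by [].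
case: n {ih} => [|n]; first by rewrite !mul0r mulr0 add0r expr0 !mulr1.
rewrite /= mulrCA -exprS mulr1 -[n.+2%:R]natr1; ring.
Qed.

End derive_rules.

(** * Moments of the semicircle density *)

Section semicircle.
Context {R : realType}.
Variables c rho : R.
Hypothesis rho0 : 0 < rho.
Local Notation mu := (@lebesgue_measure R).
Implicit Types (x : R) (n : nat).

Definition semidisc x := rho ^+ 2 - (x - c) ^+ 2.
Definition semicircle x := Num.sqrt (semidisc x).
Definition semicircle_moment n : R :=
  \int[mu]_(x in `[c - rho, c + rho]) (x ^+ n * semicircle x).

Lemma is_derive_semidisc x : is_derive x 1 semidisc (- 2 * (x - c)).
Proof.
have h := is_derive_mulfun (is_derive_subc x c) (is_derive_subc x c).
have := is_derive_subfun (is_derive_cst (rho ^+ 2) x 1) h.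
suff -> : 0 - ((x - c) * 1 + (x - c) * 1) = - 2 * (x - c) by [].
ring.
Qed.

Lemma continuous_semicircle : continuous semicircle.
Proof.
move=> x; apply: continuous_comp; last exact: sqrt_continuous.
by apply: differentiable_continuous; apply/derivable1_diffP;
  have [] := is_derive_semidisc x.
Qed.

Lemma semidisc_gt0 x : x \in `]c - rho, c + rho[ -> 0 < semidisc x.
Proof.
rewrite in_itv/= => /andP[xl xr]; rewrite /semidisc subr_gt0 -ltr_sqrt;
  last first.
  by rewrite exprn_gt0.
by rewrite !sqrtr_sqr (gtr0_norm rho0) ltr_norml; apply/andP; split; lra.
Qed.

Lemma is_derive_semicircle x : x \in `]c - rho, c + rho[ ->
  is_derive x 1 semicircle (- (x - c) / semicircle x).
Proof.
move=> /semidisc_gt0 x0.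
have h1 := is_derive_semidisc x.
have h2 := is_derive1_sqrt x0.
have := @is_derive1_comp _ _ _ _ _ _ h2 h1.
suff -> : (2 * Num.sqrt (semidisc x))^-1 * (-2 * (x - c)) = -
  (x - c) / semicircle x by [].
rewrite -/(semicircle x); field.
by rewrite /semicircle gt_eqF// sqrtr_gt0.
Qed.

Lemma FTC_semicircle (F f : R -> R) : continuous f -> continuous F ->
  (forall x, x \in `]c - rho, c + rho[ -> is_derive x (1 : R) F (f x)) ->
  \int[mu]_(x in `[c - rho, c + rho]) f x = F (c + rho) - F (c - rho).
Proof.
move=> cf cF dF; rewrite /Rintegral (@continuous_FTC2 _ f F).
- by rewrite -EFinB.
- by rewrite ltrD2l gtrN.
- exact: continuous_subspaceT.
- split.
  + by move=> x /dF[].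
  + exact/cvg_at_right_filter/cF.
  + exact/cvg_at_left_filter/cF.
- by move=> x /dF dx; rewrite derive1E; exact: derive_val.
Qed.

Lemma semicircle_edge : semicircle (c + rho) = 0 /\ semicircle (c - rho) = 0.
Proof.
rewrite /semicircle /semidisc (_ : c + rho - c = rho); last ring.
by rewrite (_ : c - rho - c = - rho) ?sqrrN ?subrr ?sqrtr0//; ring.
Qed.

Lemma continuous_moment n : continuous (fun x => x ^+ n * semicircle x).
Proof.
move=> x; apply: cvgM; last exact: continuous_semicircle.
exact: exprn_continuous.
Qed.

Lemma integrable_semicircle (f : R -> R) : continuous f ->
  mu.-integrable `[c - rho, c + rho] (EFin \o f).
Proof.
move=> cf; apply: continuous_compact_integrable; first exact: segment_compact.
exact: continuous_subspaceT.
Qed.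

Lemma semicircle_moment0 : semicircle_moment 0 = pi * rho ^+ 2 / 2.
Proof.
(* The usual antiderivative has an arcsine; the half-angle formula turns it into an arctangent whose
   denominator stays at least [rho], so [F] is continuous up to the endpoints, where the argument is
   1 or -1. *)
pose F x := ((x - c) * semicircle x +
  2 * rho ^+ 2 * atan ((x - c) / (rho + semicircle x))) / 2.
rewrite /semicircle_moment; under eq_Rintegral do rewrite expr0 mul1r.
have cF : continuous F.
  move=> x; apply: cvgM; last exact: cvg_cst.
  have cx : (fun t => t - c) @ x --> x - c by apply: cvgB;
    [exact: cvg_id|exact: cvg_cst].
  have rs : rho + semicircle x != 0 by rewrite gt_eqF// ltr_wpDr// sqrtr_ge0.
  apply: cvgD; first by apply: cvgM => //; exact: continuous_semicircle.
  apply: cvgM; first exact: cvg_cst.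
  apply: (@continuous_comp _ _ _ (fun t =>
    (t - c) / (rho + semicircle t)) atan); last exact: continuous_atan.
  apply: cvgM => //; apply: cvgV => //.
  by apply: cvgD; [exact: cvg_cst|exact: continuous_semicircle].
have dF x : x \in `]c - rho, c + rho[ -> is_derive x (1 : R) F (semicircle x).
  move=> xI; have ds := is_derive_semicircle xI.
  have sx : 0 < semicircle x by rewrite sqrtr_gt0 semidisc_gt0.
  have rs0 : 0 < rho + semicircle x by rewrite addr_gt0.
  have rs : rho + semicircle x != 0 by rewrite gt_eqF.
  have dr := is_derive_addfun (is_derive_cst rho x 1) ds.
  have dv := is_derive_mulfun (is_derive_subc x c) 
    (@is_derive_invfun _ (fun t => rho + semicircle t) x _ rs dr).
  have da := @is_derive1_comp _ _ _ _ _ _ (is_derive1_atan _) dv.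
  have dF := is_derive_mulfun (is_derive_addfun
    (is_derive_mulfun (is_derive_subc x c) ds)
    (is_derive_mulfun (is_derive_cst (2 * rho ^+ 2) x 1) da))
    (is_derive_cst (2^-1 : R) x 1).
  apply: is_derive_eq dF _ => /=.
  have sE : semicircle x ^+ 2 = rho ^+ 2 - (x - c) ^+ 2.
    by rewrite sqr_sqrtr// ltW// semidisc_gt0.
  have vE : 1 + ((x - c) / (rho + semicircle x)) ^+ 2 = 2 * rho /
    (rho + semicircle x).
    rewrite expr_div_n (_ : (x - c) ^+ 2 = rho ^+ 2 - semicircle x ^+ 2);
      last first.
      by rewrite sE; ring.
    by field.
  rewrite vE; set u := x - c; set s := semicircle x.
  have uE : u ^+ 2 = rho ^+ 2 - s ^+ 2 by rewrite /s sE /u; ring.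
  have s0 : s != 0 by rewrite gt_eqF.
  have -> : u * (- (rho + s) ^- 2 * (0 + - u / s)) + (rho + s)^-1 * 1 =
      rho / (s * (rho + s)).
    rewrite (_ : u * (- (rho + s) ^- 2 * (0 + - u / s)) =
      u ^+ 2 / (s * (rho + s) ^+ 2)); last by field; rewrite rs s0.
    by rewrite uE; field; rewrite rs s0.
  rewrite (_ : u * (- u / s) = - (u ^+ 2 / s)); last by field.
  rewrite uE; field.
  by rewrite s0 rs gt_eqF.
rewrite (FTC_semicircle continuous_semicircle cF dF).
have [sb sa] := semicircle_edge.
rewrite /F sb sa !addr0 !mulr0 !add0r (_ : c + rho - c = rho); last ring.
rewrite (_ : c - rho - c = - rho); last ring.
rewrite mulNr mulfV ?gt_eqF// atanN atan1; by field.
Qed.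

(** Integrate the derivative of [x^n (rho^2 - (x - c)^2)^(3/2)], which vanishes at both endpoints.
    For [n = 0] the factor [n%:R] cancels the term in [n.-1]. *)
Lemma semicircle_moment_rec n :
  n.+3%:R * semicircle_moment n.+1 = (2 * n%:R + 3) * c * semicircle_moment n +
    n%:R * (rho ^+ 2 - c ^+ 2) * semicircle_moment n.-1.
Proof.
have cx i r : continuous (fun x => r * (x ^+ i * semicircle x)).
  by move=> x; apply: cvgM; [exact: cvg_cst|exact: continuous_moment].
pose f x := (n%:R * (rho ^+ 2 - c ^+ 2)) * (x ^+ n.-1 * semicircle x) +
    (((2 * n%:R + 3) * c) * (x ^+ n * semicircle x) -
     n.+3%:R * (x ^+ n.+1 * semicircle x)).
pose F x := x ^+ n * (semidisc x * semicircle x).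
have cf : continuous f.
  by move=> x; apply: cvgD; [exact: cx|apply: cvgB; exact: cx].
have cF : continuous F.
  move=> x; apply: cvgM; first exact: exprn_continuous.
  apply: cvgM; last exact: continuous_semicircle.
  by apply: differentiable_continuous; apply/derivable1_diffP;
    have [] := is_derive_semidisc x.
have dF x : x \in `]c - rho, c + rho[ -> is_derive x (1 : R) F (f x).
  move=> xI; have ds := is_derive_semicircle xI.
  have sx : semicircle x != 0 by rewrite gt_eqF// sqrtr_gt0 semidisc_gt0.
  have dF := is_derive_mulfun (is_derive_expfun n x)
    (is_derive_mulfun (is_derive_semidisc x) ds).
  apply: is_derive_eq dF _ => /=.
  rewrite (_ : semidisc x * (- (x - c) / semicircle x) = -
    (x - c) * semicircle x); last first.
    have -> : semidisc x = semicircle x ^+ 2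
      by rewrite sqr_sqrtr// ltW// semidisc_gt0.
    by field.
  have zn : n%:R * x ^+ n = n%:R * (x * x ^+ n.-1).
    by case: (n) => [|k]; rewrite ?mul0r// exprS.
  have n3 : n.+3%:R = n%:R + 3 :> R by rewrite -addn3 natrD.
  rewrite /f /semidisc [x ^+ n.+1]exprS n3.
  have -> : (2 * n%:R + 3) * c * (x ^+ n * semicircle x) =
    2 * c * semicircle x * (n%:R * x ^+ n) + 3 * c * (x ^+ n * semicircle x)
      by ring.
  have -> : (n%:R + 3) * (x * x ^+ n * semicircle x) =
    x * semicircle x * (n%:R * x ^+ n) + 3 * (x * x ^+ n * semicircle x)
      by ring.
  rewrite zn; ring.
have : \int[mu]_(x in `[c - rho, c + rho]) f x = 0.
  rewrite (FTC_semicircle cf cF dF) /F.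
  have [-> ->] := semicircle_edge.
  by rewrite !mulr0 subr0.
rewrite /f.
rewrite RintegralD//; [|exact/integrable_semicircle/cx|]; last first.
  by apply: integrable_semicircle => x; apply: cvgB; exact: cx.
rewrite RintegralB//; [|exact/integrable_semicircle/cx..].
rewrite !RintegralZl//; [|exact/integrable_semicircle/continuous_moment..].
rewrite -/(semicircle_moment _) -/(semicircle_moment _) -/(semicircle_moment _).
lra.
Qed.

End semicircle.

Section quadratic_recurrence.
Context {R : realFieldType}.

(* The generating function of [j] satisfies a linear differential equation
   of order one; symmetrizing the corresponding recurrence of the Cauchy square
   of [j] gives its quadratic equation. *)
Lemma quadratic_recurrence (j : nat ->
  R) (a c d : R) : j 0%N * a * 4 = d + c ^+ 2 ->
  (forall n, n.+3%:R * j n.+1 = (2 * n%:R + 3) * c * j n + n%:R * d * j n.-1) ->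
  forall n, j n.+2 = c * j n.+1 + a * \sum_(i < n.+1) j i * j (n - i)%N.
Proof.
move=> j0 jS.
(* The shifted index makes [S 0 = 0], so that the claim [key] also covers [j 1 = c * j 0]. *)
pose S n := \sum_(i < n) j i * j (n.-1 - i)%N.
have n3 n : n.+3%:R = n%:R + 3 :> R by rewrite -addn3 natrD.
have Sidx n : 2 * \sum_(i < n.+1) i%:R * (j i * j (n - i)%N) = n%:R * S n.+1.
  rewrite mulr_natl mulr2n {2}(reindex_inj rev_ord_inj)/= -big_split/=
    mulr_sumr.
  apply: eq_bigr => i _; rewrite subSS subKn -1?ltnS//.
  rewrite [j (n - i)%N * _]mulrC -mulrDl -natrD subnKC// -ltnS//.
have SS n : (n%:R + 5) * S n.+2 =
    4 * j 0%N * j n.+1 + 2 * (n%:R + 3) * c * S n.+1 + (n%:R + 1) * d * S n.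
  have h1 : \sum_(i < n.+1) i.+3%:R * j i.+1 * j (n - i)%N =
      c * (2 * \sum_(i < n.+1) i%:R * (j i * j (n - i)%N)) + 3 * c * S n.+1 +
      d * \sum_(i < n.+1) i%:R * (j i.-1 * j (n - i)%N).
    rewrite /S !mulr_sumr -!big_split/=; apply: eq_bigr => i _.
    by rewrite jS; ring.
  have h2 : 2 * \sum_(i < n.+1) i%:R * (j i.-1 * j (n - i)%N) =
    (n%:R + 1) * S n.
    rewrite big_ord_recl/= mul0r add0r; case: (n) => [|k].
      by rewrite /S !big_ord0 !mulr0.
    have -> : \sum_(i < k.+1) (bump 0 i)%:R * (j (bump 0 i).-1 * j
      (k.+1 - bump 0 i)%N) =
        \sum_(i < k.+1) i%:R * (j i * j (k - i)%N) + S k.+1.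
      rewrite /S -big_split/=; apply: eq_bigr => i _.
      by rewrite /bump/= add1n subSS -[i.+1%:R]natr1; ring.
    by rewrite mulrDr Sidx -[k.+1%:R]natr1; ring.
  have h3 : 2 * \sum_(i < n.+2) i%:R * (j i * j (n.+1 - i)%N) + 4 * S n.+2 =
      4 * j 0%N * j n.+1 + 2 * \sum_(i < n.+1) i.+3%:R * j i.+1 * j (n - i)%N.
    rewrite /S !(big_ord_recl n.+1)/= subn0 mul0r add0r.
    have -> : \sum_(i < n.+1) (bump 0 i)%:R * (j (bump 0 i) * j
      (n.+1 - bump 0 i)%N) =
      \sum_(i < n.+1) i.+3%:R * j i.+1 * j (n - i)%N -
        2 * \sum_(i < n.+1) j (bump 0 i) * j (n.+1 - bump 0 i)%N.
      rewrite mulr_sumr -sumrB; apply: eq_bigr => i _.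
      by rewrite /bump/= add1n subSS n3 -[i.+1%:R]natr1; ring.
    ring.
  rewrite Sidx -[n.+1%:R]natr1 in h3; rewrite Sidx in h1.
  have -> : (n%:R + 5) * S n.+2 = (n%:R + 1) * S n.+2 + 4 * S n.+2 by ring.
  by rewrite h3 h1 -[(n%:R + 1) * d * _]mulrAC -h2; ring.
have key n : a * S n = j n.+1 - c * j n.
  have j1 : j 1%N = c * j 0%N by have := jS 0%N; rewrite /= mul0r; lra.
  suff : a * S n = j n.+1 - c * j n /\ a * S n.+1 = j n.+2 - c * j n.+1 by case.
  elim: n => [|n [ih1 ih2]].
    rewrite /S big_ord0 big_ord1 mulr0 j1 subrr; split=> //.
    have := jS 1%N; rewrite /= j1 => j2.
    have h4 : (4 : R) != 0 by rewrite pnatr_eq0.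
    apply: (mulfI h4).
    rewrite (_ : 4 * (a * (j 0%N * j 0%N)) = j 0%N * a * 4 * j 0%N); last ring.
    by rewrite j0 mulrBr j2; ring.
  split=> //.
  have n5 : n%:R + 5 != 0 :> R by rewrite gt_eqF// ltr_wpDl.
  apply: (mulfI n5).
  rewrite (_ : (n%:R + 5) * (a * S n.+2) = a * ((n%:R + 5) * S n.+2));
    last ring.
  rewrite SS.
  have N2 : n.+2%:R = n%:R + 2 :> R by rewrite -addn2 natrD.
  have N1 : n.+1%:R = n%:R + 1 :> R by rewrite -addn1 natrD.
  have e2 : (n%:R + 2 + 3) * j n.+3 =
      (2 * (n%:R + 2) + 3) * c * j n.+2 + (n%:R + 2) * d * j n.+1.
    by rewrite -N2 -(n3 n.+2); exact: jS.
  have e1 : (n%:R + 1 + 3) * j n.+2 =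
      (2 * (n%:R + 1) + 3) * c * j n.+1 + (n%:R + 1) * d * j n.
    by rewrite -N1 -(n3 n.+1); exact: jS.
  apply/eqP; rewrite -subr_eq0.
  (* The difference is a combination of the initial condition, the two induction hypotheses and the
     recurrences [e2] and [e1], each written as an expression equal to zero. *)
  rewrite (_ : _ - _ =
     j n.+1 * (j 0%N * a * 4 - (d + c ^+ 2)) +
     2 * (n%:R + 3) * c * (a * S n.+1 - (j n.+2 - c * j n.+1)) +
     (n%:R + 1) * d * (a * S n - (j n.+1 - c * j n)) -
     ((n%:R + 2 + 3) * j n.+3 - ((2 * (n%:R + 2) + 3) * c * j n.+2 +
       (n%:R + 2) * d * j n.+1)) +
     c * ((n%:R + 1 + 3) * j n.+2 - ((2 * (n%:R + 1) + 3) * c * j n.+1 +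
       (n%:R + 1) * d * j n)));
    last ring.
  by rewrite j0 ih1 ih2 e1 e2 !subrr !mulr0 !addr0 subr0.
by move=> n; have := key n.+1; rewrite /S/= => ->; rewrite addrC subrK.
Qed.

End quadratic_recurrence.

Section free_poisson_moments.
Context {R : realType}.
Variables lambda alpha : R.
Hypothesis lambda0 : 0 <= lambda.
Hypothesis alpha0 : 0 < alpha.
Local Notation mu := (@lebesgue_measure R).
Let g := free_poisson_density lambda alpha.
Let c := alpha * (1 + lambda).
Let rho := 2 * alpha * Num.sqrt lambda.

Import HBNNSimple.

(** For an indicator this is the definition of [free_poisson_ac]; linearity gives simple functions,
    and monotone convergence the rest. *)
Lemma ge0_integral_free_poisson_ac (f : R -> \bar R) :
  (forall x, 0 <= f x)%E -> measurable_fun [set: R] f ->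
  (\int[free_poisson_ac lambda alpha]_x f x = \int[mu]_x (f x * (g x)%:E))%E.
Proof.
move=> f0 mf.
have mg : measurable_fun [set: R] (EFin \o g).
  by apply/measurable_EFinP; exact: measurable_free_poisson_density.
have g0 x : (0 <= (g x)%:E)%E by rewrite lee_fin free_poisson_density_ge0.
pose h := nnsfun_approx measurableT mf.
have mh n : measurable_fun [set: R] (EFin \o h n).
  by apply/measurable_EFinP; exact/measurable_funP.
have hh (x : R) a b : (a <= b)%N -> h a x <= h b x.
  by move=> ab; exact/lefP/nd_nnsfun_approx.
have -> : (\int[free_poisson_ac lambda alpha]_x f x =
    lim (\int[free_poisson_ac lambda alpha]_x (EFin \o h n) x @[n --> \oo]))%E.
  have fE x : f x = lim ((EFin \o h n) x @[n --> \oo]).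
    by apply/esym/cvg_lim => //; exact: cvg_nnsfun_approx.
  under eq_integral => x _ do rewrite fE.
  apply: monotone_convergence => //.
  - by move=> n x _ /=; rewrite lee_fin.
  - by move=> x _ a b ab; rewrite lee_fin; exact: hh.
have -> : (\int[mu]_x (f x * (g x)%:E) =
    lim (\int[mu]_x ((EFin \o h n) \* (EFin \o g)) x @[n --> \oo]))%E.
  have fE x : (f x * (g x)%:E = lim (((EFin \o h n) \*
    (EFin \o g)) x @[n --> \oo]))%E.
    by apply/esym/cvg_lim => //; apply: cvgeZr => //; exact: cvg_nnsfun_approx.
  under eq_integral => x _ do rewrite fE.
  apply: monotone_convergence => //.
  - by move=> n; apply: emeasurable_funM; [exact: mh|exact: mg].
  - by move=> n x _ /=; rewrite mule_ge0 ?lee_fin// free_poisson_density_ge0.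
  - by move=> x _ a b ab /=; rewrite lee_wpmul2r// lee_fin; exact: hh.
suff suf n : (\int[mu]_x ((EFin \o h n) x * (g x)%:E) =
    \int[free_poisson_ac lambda alpha]_x (EFin \o h n) x)%E.
  by under [in RHS]eq_fun do rewrite suf.
transitivity (\int[free_poisson_ac lambda alpha]_x
   (\sum_(y \in range (h n)) (y * \1_(h n @^-1` [set y]) x)%:E))%E; last first.
  by apply: eq_integral => t tE; rewrite /= fimfunE -fsumEFin.
have indich m r : measurable_fun [set: R] (fun x =>
  (r * \1_(h m @^-1` [set r]) x)%:E).
  by apply: (measurable_comp measurableT) => //; exact: measurable_funM.
have mi r : measurable_fun [set: R] (fun x =>
  (\1_(h n @^-1` [set r]) x)%:E : \bar R).
  exact/measurable_EFinP.
rewrite ge0_integral_fsum//; last by move=> m y Ey; exact: nnfun_muleindic_ge0.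
transitivity (\int[mu]_x (\sum_(y \in range (h n))
    (y * \1_(h n @^-1` [set y]) x)%:E * (g x)%:E))%E.
  apply: eq_integral => x _.
  rewrite -ge0_mule_fsuml => [|y]; last exact: nnfun_muleindic_ge0.
  by congr (_ * _)%E; rewrite /= fimfunE -fsumEFin.
rewrite ge0_integral_fsum//; last 2 first.
  - by move=> y; apply: emeasurable_funM; [exact: indich|exact: mg].
  - by move=> m y Ey; rewrite mule_ge0// nnfun_muleindic_ge0.
apply: eq_fsbigr => r rhn.
under [RHS]eq_integral do rewrite EFinM.
rewrite integralZl_indic_nnsfun => //.
under eq_integral do rewrite EFinM -muleA.
rewrite ge0_integralZl//.
- congr (_ * _)%E; rewrite integral_indic// setIT.
  rewrite /= /free_poisson_ac [RHS]integral_mkcond; apply: eq_integral => x _.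
  by rewrite muleC epatch_indic.
- by apply: emeasurable_funM; [exact: mi|exact: mg].
- by move=> t _; rewrite mule_ge0// lee_fin.
- by move: rhn; rewrite inE /= => -[x _ <-]; rewrite lee_fin.
Qed.

(** [f 0 = 0] removes the contribution of the atom; it holds for the powers [x ^+ n.+1]. *)
Lemma ge0_integral_free_poisson (f : R -> \bar R) :
  (forall x, 0 <= f x)%E -> measurable_fun [set: R] f -> f 0 = 0%E ->
  (\int[free_poisson_measure lambda alpha]_x f x = \int[mu]_x (f x *
    (g x)%:E))%E.
Proof.
move=> f0 mf f00; rewrite /free_poisson_measure ge0_integral_measure_add//.
rewrite ge0_integral_mscale// integral_dirac// f00 !mule0 add0e.
exact: ge0_integral_free_poisson_ac.
Qed.

Let itvE : (alpha * (1 - Num.sqrt lambda) ^+ 2 = c - rho) *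
  (alpha * (1 + Num.sqrt lambda) ^+ 2 = c + rho).
Proof.
have ss := sqr_sqrtr lambda0.
by split; rewrite /c /rho -{2}ss; ring.
Qed.

Let rhoE : 4 * lambda * alpha ^+ 2 = rho ^+ 2.
Proof. by rewrite /rho !exprMn sqr_sqrtr//; ring. Qed.

Lemma free_poisson_densityX n x : x ^+ n.+1 * g x =
  ((fun y => (2 * pi * alpha)^-1 * (y ^+ n * semicircle c rho y))
     \_ `[c - rho, c + rho]) x.
Proof.
rewrite /g /free_poisson_density !itvE patchE; case: ifPn => [/andP[ax xb]|].
  rewrite mem_set; last by rewrite /= in_itv/= !ltW.
  have [_ x0] : 0 < alpha /\ 0 < x.
    by apply: (@free_poisson_support_gt0 _ lambda); rewrite itvE.
  rewrite /semicircle /semidisc -rhoE exprS.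
  by move: (pi) (pi_gt0 R) => p p0; field; rewrite !gt_eqF.
rewrite mulr0 => h; case: ifPn => //; rewrite inE/= in_itv/= => /andP[ax xb].
(* The density lives on the open interval and the right-hand side on the closed one; at the two
   remaining points the semicircle vanishes. *)
have : semicircle c rho x = 0.
  move: h; rewrite negb_and -!leNgt => /orP[xa|bx].
    have -> : x = c - rho by apply/le_anti; rewrite xa ax.
    rewrite /semicircle /semidisc (_ : _ - _ = 0) ?sqrtr0//; ring.
  have -> : x = c + rho by apply/le_anti; rewrite xb bx.
  rewrite /semicircle /semidisc (_ : _ - _ = 0) ?sqrtr0//; ring.
by move=> ->; rewrite !mulr0.
Qed.

Lemma free_poisson_moment n :
  \int[free_poisson_measure lambda alpha]_x (x ^+ n.+1) =
  (2 * pi * alpha)^-1 * semicircle_moment c rho n.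
Proof.
have mX : measurable_fun [set: R] (fun x : R => (x ^+ n.+1)%:E).
  by apply/measurable_EFinP; exact: exprn_measurable.
have fg (s : R) x : 0 <= s -> (s%:E * (g x)%:E = (s * g x)%:E)%E by [].
have gneg x : x <= 0 -> g x = 0.
  move=> x0; rewrite /g /free_poisson_density; case: ifPn => // /andP[h1 h2].
  by have [_] := free_poisson_support_gt0 h1 h2; rewrite ltNge x0.
rewrite /Rintegral integralE ge0_integral_free_poisson//; last 2 first.
- exact: measurable_funepos.
- by rewrite funeposE expr0n/= maxxx.
rewrite ge0_integral_free_poisson//; last 2 first.
- exact: measurable_funeneg.
- by rewrite funenegE expr0n/= oppr0 maxxx.
rewrite [X in (_ - X)%E]integral0_eq ?sube0; last first.
  move=> x _; have [x0|x0] := leP x 0; first by rewrite gneg// mule0.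
  by rewrite funenegE max_r ?mul0e// leeNl oppe0 lee_fin exprn_ge0// ltW.
transitivity (fine (\int[mu]_x (((fun y =>
  (2 * pi * alpha)^-1 * (y ^+ n * semicircle c rho y))
     \_ `[c - rho, c + rho]) x)%:E)).
  congr fine; apply: eq_integral => x _; rewrite -free_poisson_densityX.
  have [x0|x0] := leP x 0; first by rewrite gneg// mulr0 mule0.
  by rewrite funeposE max_l// lee_fin exprn_ge0// ltW.
rewrite -/(Rintegral mu setT _) -Rintegral_mkcond RintegralZl//.
exact/integrable_semicircle/continuous_moment.
Qed.

Let j n := (2 * pi * alpha)^-1 * semicircle_moment c rho n.

Let jS n : n.+3%:R * j n.+1 = (2 * n%:R + 3) * c * j n +
  n%:R * (rho ^+ 2 - c ^+ 2) * j n.-1.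
Proof.
(* For [lambda = 0] the radius is zero, outside the scope of the semicircle lemmas; the integrals
   then run over a single point. *)
have [l0|l0] := eqVneq lambda 0.
  have r0 : rho = 0 by rewrite /rho l0 sqrtr0 mulr0.
  have j0 k : j k = 0.
    rewrite /j /semicircle_moment r0 subr0 addr0 set_itv1 Rintegral_set1.
    by rewrite mulr0.
  by rewrite !j0 !mulr0 addr0.
have r0 : 0 < rho by rewrite !mulr_gt0// sqrtr_gt0 lt_neqAle eq_sym l0.
rewrite /j mulrCA semicircle_moment_rec//; ring.
Qed.

Let j0 : j 0 = alpha * lambda.
Proof.
have [l0|l0] := eqVneq lambda 0.
  have r0 : rho = 0 by rewrite /rho l0 sqrtr0 mulr0.
  rewrite /j /semicircle_moment r0 subr0 addr0 set_itv1 Rintegral_set1.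
  by rewrite l0 !mulr0.
have r0 : 0 < rho by rewrite !mulr_gt0// sqrtr_gt0 lt_neqAle eq_sym l0.
rewrite /j semicircle_moment0// -rhoE.
by move: (pi) (pi_gt0 R) => p p0; field; rewrite !gt_eqF.
Qed.

(** The moments are shifted, [m n.+1 = j n]. The summand [i = 0] of the convolution, where
    [m 0 = 1], accounts for the gap between the coefficient [c = alpha (1 + lambda)] of [j] and
    [alpha * lambda]. *)
Lemma free_poisson_moment_rec (m : nat -> R) : m 0 = 1 ->
  (forall n, m n.+1 = \int[free_poisson_measure lambda alpha]_x (x ^+ n.+1)) ->
  forall n, m n.+1 = alpha * lambda * m n +
    alpha * \sum_(i < n) m i * m (n - i)%N.
Proof.
move=> m0 mS.
have mj n : m n.+1 = j n by rewrite mS free_poisson_moment.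
have q : j 0 * alpha * 4 = rho ^+ 2 - c ^+ 2 + c ^+ 2 by rewrite j0 -rhoE; ring.
case=> [|[|n]].
- by rewrite mj m0 j0 big_ord0; ring.
- rewrite big_ord1 m0 !mj; have := jS 0; rewrite mul0r mul0r addr0 mulr0 add0r.
  have h3 : (3 : R) != 0 by rewrite pnatr_eq0.
  by rewrite -mulrA => /(mulfI h3) ->; rewrite /c; ring.
rewrite !mj (quadratic_recurrence q jS) [\sum_(i < n.+2) _]big_ord_recl/= m0
  mul1r subn0 mj.
have -> : \sum_(i < n.+1) m (bump 0 i) * m (n.+2 - bump 0 i)%N =
   \sum_(i < n.+1) j i * j (n - i)%N.
  apply: eq_bigr => i _; rewrite /bump/= add1n subSS mj subSn ?mj//.
  by rewrite -ltnS.
by rewrite /c; ring.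
Qed.

End free_poisson_moments.

Lemma free_poisson_recurrence (R : realType) (A : cstarAlgType R)
    (phi : {scalar A}) (lambda alpha : R) (X : A) : phi 1 = 1 ->
  0 <= lambda -> 0 < alpha -> free_poisson phi lambda alpha X ->
  forall j, phi (X ^+ j.+1) = (alpha * lambda)%:C%C * phi (X ^+ j) +
     alpha%:C%C * \sum_(i < j) phi (X ^+ i) * phi (X ^+ (j - i)).
Proof.
move=> phi1 l0 a0 [_ _ Xm] j.
pose m n : R := if n is n'.+1 then
  \int[free_poisson_measure lambda alpha]_x (x ^+ n'.+1) else 1.
have mE n : phi (X ^+ n) = (m n)%:C%C.
  by case: n => [|n]; [rewrite expr0|rewrite (Xm _ _).2].
rewrite mE (free_poisson_moment_rec l0 a0
  (m := m))// rmorphD !rmorphM rmorph_sum.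
rewrite mE; congr (_ + _ * _); apply: eq_bigr => i _.
by rewrite !mE rmorphM.
Qed.

(** * Conjugation *)

Section conjugation.
Context {R : realType} {A : cstarAlgType R} (phi : {scalar A}).
Variables (w w' : A).
Hypothesis ww' : w * w' = 1.
Hypothesis w'w : w' * w = 1.

Lemma conjugationM a b : w * (a * b) * w' = w * a * w' * (w * b * w').
Proof. by rewrite -!mulrA (mulrA w' w) w'w mul1r. Qed.

Lemma subalgebra_gen_conj x a : subalgebra_gen x a ->
  subalgebra_gen (w * x * w') (w * a * w').
Proof.
pose P a := subalgebra_gen (w * x * w') (w * a * w').
move/(_ P); apply; split; last first.
  move=> _ [->|->]; first exact: subalgebra_gen_id.
  by rewrite /P mulr1 ww'; exact: subalgebra_gen1.
split.
- by rewrite /P mulr1 ww'; exact: subalgebra_gen1.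
- move=> k u v uP vP.
  by rewrite /P mulrDr mulrDl -scalerAr -scalerAl; exact: subalgebra_gen_lin.
- by move=> u v uP vP; rewrite /P conjugationM; exact: subalgebra_genM.
Qed.

Hypothesis phitr : tracial phi.

Lemma phi_conj a : phi (w * a * w') = phi a.
Proof. by rewrite phitr mulrA w'w mul1r. Qed.

Lemma alternating_conj x y b e a :
  alternating phi (gen_subalgebra x y) b e a ->
  alternating phi (gen_subalgebra (w * x * w') (w * y * w')) b e (w * a * w').
Proof.
have conj c u : gen_subalgebra x y c u ->
    gen_subalgebra (w * x * w') (w * y * w') c (w * u * w').
  by case: c; exact: subalgebra_gen_conj.
elim=> {b e a} [b a ab a0|b e a z ab a0 _ ih].
  by apply: alternating1; [exact: conj|rewrite phi_conj].
by rewrite conjugationM; apply: alternatingS; [exact: conj|rewrite phi_conj|].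
Qed.

End conjugation.

(** * Freeness of [U] and [V] *)

Theorem theorem4p2 (R : realType) (A : cstarAlgType R) (phi : {scalar A})
    (X Y : A) (lambda kappa alpha : R) :
  state phi -> faithful phi -> tracial phi ->
  0 <= lambda -> 0 <= kappa -> 0 < alpha -> 1 < lambda + kappa ->
  free_pair phi X Y ->
  free_poisson phi lambda alpha X ->
  free_poisson phi kappa alpha Y ->
  let V := X + Y in
  let U := inv_sqrt V * X * inv_sqrt V in
  is_inv_sqrt V (inv_sqrt V) /\ free_pair phi U V.
Proof.
move=> sphi fphi phitr l0 k0 a0 lk1 XYfree Xp Yp V U.
have phi1 : phi 1 = 1 by case: sphi.
pose g (b : bool) := if b then X else Y.
pose m (b : bool) := (alpha * (if b then lambda else kappa))%:C%C.
have gE b j : phi (g b ^+ j.+1) = m b * phi (g b ^+ j) +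
     alpha%:C%C * \sum_(i < j) phi (g b ^+ i) * phi (g b ^+ (j - i)).
  case: b; [exact: (free_poisson_recurrence phi1 l0 a0 Xp)|].
  exact: (free_poisson_recurrence phi1 k0 a0 Yp).
have gfree : forall b e a,
    alternating phi (fun b => subalgebra_gen (g b)) b e a -> phi a = 0.
  exact: free_pair_alternating XYfree.
pose G y := exists b, y = dgen phi (g b).
have Gsd x : dalg G x ->
    schwinger_dyson phi V (alpha * (lambda + kappa))%:C%C alpha%:C%C x.
  by move=> /(free_schwinger_dyson phi1 gfree gE); rewrite mulrDr rmorphD.
have GV : dalg G (dgen phi V).
  suff -> : dgen phi V = dlin 1 (dgen phi X) (dgen phi Y).
    by apply: dalg_lin; apply: dalg_gen; [exists true|exists false].
  apply: dpair_eq => [|u v] /=; first by rewrite scale1r.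
  by rewrite mulrDl stateD; ring.
have Vsd x : dalg (eq^~ (dgen phi V)) x ->
    schwinger_dyson phi V (alpha * (lambda + kappa))%:C%C alpha%:C%C x.
  by move=> xV; apply: Gsd; apply: dalg_sub xV => _ ->.
have Vsa : selfadjoint V by apply: selfadjointD; [case: Xp|case: Yp].
pose c := alpha * (1 + (lambda + kappa)); pose Z := 1 - c^-1%:C%C *: V.
have c0 : 0 < c by rewrite mulr_gt0// addr_gt0// (lt_trans _ lk1).
have Z1 : cnorm Z < 1.
  exact: (cnorm_free_poisson_sum sphi a0 lk1 Vsd (c := c) erefl erefl).
have [w0 hw0] := free_poisson_sum_inv_sqrt sphi a0 lk1 Vsd
  (c := c) erefl erefl fphi Vsa.
(* Existence of [w0] rules out the default value of [inv_sqrt]. *)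
have hw : is_inv_sqrt V (inv_sqrt V)
  by apply: (@xgetPex _ 0 [set w | is_inv_sqrt V w]); exists w0.
split=> //; move: @U hw; move: (inv_sqrt V) => w U [_ wwV Vww].
have wV : w * V = V * w.
  have -> : w * V = V * (w * w) * (w * V) by rewrite Vww mul1r.
  by rewrite -!mulrA [w * (w * V)]mulrA wwV mulr1.
pose W := w * w * X.
have Gbil x : G x -> dbilin x by move=> [b ->]; exact: dbilin_dgen.
have Gbd x : G x -> dbounded x by move=> [b ->]; exact: (dbounded_dgen sphi).
have Tlim : dlimit G (dinv phi (w * w))
  by exact: (dlimit_inv sphi c0 Vww Z1 GV).
have Wlim : dlimit G (W, fun _ _ => 0).
  have Xlim : dlimit G (dgen phi X).
    by apply: dlimit_dalg => //; apply: dalg_gen; exists true.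
  (* By the Leibniz rule the derivative of the product is - V^-1 (x) X + V^-1 (x) X = 0. *)
  suff -> : (W, fun _ _ => 0) = dmul (dinv phi (w * w)) (dgen phi X).
    exact: dlimit_mul.
  by apply: dpair_eq => //= u v; rewrite addNr.
have VWsd x : dalg (fun y => y = dgen phi V \/ y = (W, fun _ _ => 0)) x ->
    schwinger_dyson phi V (alpha * (lambda + kappa))%:C%C alpha%:C%C x.
  move=> xG; apply: (@dlimit_schwinger_dyson _ _ _ sphi G) Gsd.
  elim: xG => {x} [x [->|->] //||k x y _ ? _ ?|x y _ ? _ ?].
  - exact: dlimit_dalg.
  - by apply: dlimit_dalg => //; exact: dalg1.
  - exact: dlimit_lin.
  - exact: dlimit_mul.
pose w' := V * w.
have w'w : w' * w = 1 by rewrite /w' -mulrA.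
have ww' : w * w' = 1 by rewrite /w' -wV mulrA.
apply: alternating_free_pair => b e a /(alternating_conj ww' w'w phitr).
have -> : w * U * w' = W.
  by rewrite /U -!mulrA ww' mulr1 /W mulrA.
have -> : w * V * w' = V by rewrite wV -mulrA ww' mulr1.
by move=> /(schwinger_dyson_free phi1 phitr VWsd); rewrite phi_conj.
Qed.
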